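(* There exists an integer $N_0\ge 4$ such that $f(n)=U(n)$ for every integer $n\ge N_0$.
   Context: For a positive integer $n$, the Farey sequence of order $n$ is $\mathcal F_n=(a_0/b_0,a_1/b_1,\dots)$, the increasing sequence of all reduced fractions $a/b\in[0,1]$ with $1\le b\le n$ (including $0=0/1$ and $1=1/1$); $|\mathcal F_n|$ is its number of terms, indexed from $0$ to $|\mathcal F_n|-1$. For $n\ge4$ define $$f(n):=\min\{\,j-i-1:\ 0\le i<j<|\mathcal F_n|,\ (a_j-a_i)(b_j-b_i)<0\,\}.$$ For an integer $n\ge4$, write $n=4m+r$ with $m\ge1$ and $r\in\{0,1,2,3\}$, and define $U(n):=m+1$ if $r=0$, $U(n):=m+2$ if $r\in\{1,2\}$, and $U(n):=m+4$ if $r=3$. *)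

(* Defs.v *)
From mathcomp Require Import all_boot all_order all_algebra.
Set Implicit Arguments.
Unset Strict Implicit.
Unset Printing Implicit Defensive.
Import Order.TTheory GRing.Theory Num.Theory.

Local Open Scope ring_scope.

(* Terms of a Farey sequence are rationals, so that [numq] and [denq] give the
   numerator and the (positive) denominator of their reduced forms. *)
Definition farey (n : nat) : seq rat :=
  sort <=%R [seq a%:Q / b%:Q | b : nat <- iota 1 n,
                               a : nat <- [seq a <- iota 0 b.+1 | coprime a b]].

Definition farey_num (n i : nat) : int := numq (farey n)`_i.
Definition farey_den (n i : nat) : int := denq (farey n)`_i.

Definition opp_ordered (n i j : nat) : bool :=
  (farey_num n j - farey_num n i) * (farey_den n j - farey_den n i) < 0.

(* The default value [size (farey n)] exceeds every gap j - i - 1; it is the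
   value of [farey_gap n] only when no pair is admissible, that is for n < 4
   (see [farey_gapP]). *)
Definition farey_gap (n : nat) : nat :=
  \big[minn/size (farey n)]_(p : 'I_(size (farey n)) * 'I_(size (farey n)) |
      (p.1 < p.2)%N && opp_ordered n p.1 p.2) (p.2 - p.1 - 1)%N.

Definition U (n : nat) : nat :=
  let m := (n %/ 4)%N in
  match (n %% 4)%N with
  | 0 => (m + 1)%N
  | 1 | 2 => (m + 2)%N
  | _ => (m + 4)%N
  end.

Lemma fracq_coprime (a b : nat) : (0 < b)%N -> coprime a b ->
  numq (a%:Q / b%:Q) = a /\ denq (a%:Q / b%:Q) = b.
Proof.
move=> b0 cab.
have cab' : coprime `|Posz a| `|Posz b| by [].
rewrite coprimeq_num // coprimeq_den //.
have -> : Num.sg (b%:Z) = 1 by apply: gtr0_sg; rewrite ltz_nat.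
by rewrite mul1r eqz_nat; case: eqP b0 => [->|].
Qed.

Lemma mem_farey (n : nat) (x : rat) :
  (x \in farey n) = (0 <= x <= 1) && (denq x <= n%:Z).
Proof.
rewrite mem_sort; apply/allpairsPdep/idP => [[b [a []]]|].
  rewrite mem_iota mem_filter mem_iota => /andP[b0 bn] /andP[cab /= ab] ->.
  have [_ ->] := fracq_coprime b0 cab.
  rewrite divr_ge0 ?ler0n //= ler_pdivrMr ?ltr0n // mul1r ler_nat.
  by rewrite lez_nat; move: ab bn; rewrite add0n add1n !ltnS => -> ->.
move=> /andP[/andP[x0 x1] dn].
have n0 : 0 <= numq x by rewrite numq_ge0.
exists `|denq x|%N, `|numq x|%N; split.
- rewrite mem_iota add1n ltnS absz_gt0 denq_eq0 /=.
  by rewrite -lez_nat gez0_abs ?denq_ge0.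
- rewrite mem_filter coprime_num_den mem_iota /= add0n ltnS.
  rewrite -lez_nat !gez0_abs ?denq_ge0 //.
  move: x1; rewrite -{1}[x]divq_num_den ler_pdivrMr ?ltr0z ?denq_gt0 //.
  by rewrite mul1r ler_int.
- by rewrite !gez0_abs ?denq_ge0 // divq_num_den.
Qed.

Lemma farey_sorted (n : nat) : sorted <%R (farey n).
Proof.
rewrite lt_sorted_uniq_le sort_uniq sort_le_sorted andbT.
apply: allpairs_uniq_dep; first exact: iota_uniq.
  by move=> b _; rewrite filter_uniq ?iota_uniq.
move=> _ _ /allpairsPdep[b [a [+ + ->]]] /allpairsPdep[d [c [+ + ->]]] /=.
rewrite !mem_iota !mem_filter.
move=> /andP[b0 _] /andP[cab _] /andP[d0 _] /andP[ccd _] e.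
have [en ed] := fracq_coprime b0 cab.
have [en' ed'] := fracq_coprime d0 ccd.
move: en ed; rewrite e en' ed' => -[<-] [<-].
by [].
Qed.

Lemma farey_gapP (n : nat) : (4 <= n)%N ->
  (exists i j : nat, [/\ (i < j < size (farey n))%N, opp_ordered n i j
                       & farey_gap n = (j - i - 1)%N]) /\
  (forall i j : nat, (i < j < size (farey n))%N -> opp_ordered n i j ->
     (farey_gap n <= j - i - 1)%N).
Proof.
move=> n4.
have lb (i j : nat) : (i < j < size (farey n))%N -> opp_ordered n i j ->
    (farey_gap n <= j - i - 1)%N.
  move=> /andP[ij js] oij.
  pose p := (Ordinal (ltn_trans ij js), Ordinal js).
  have: p \in index_enum ('I_(size (farey n)) * 'I_(size (farey n)))%type.
    exact: mem_index_enum.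
  rewrite /farey_gap; elim: (index_enum _) => // q s IHs.
  rewrite inE big_cons => /predU1P[<-|/IHs les]; first by rewrite ij oij geq_minl.
  by case: ifP => // _; rewrite geq_min les orbT.
split=> //.
have m1 : (1%:Q / 4%:Q) \in farey n.
  by rewrite mem_farey; have [_ ->] := @fracq_coprime 1 4 isT isT.
have m2 : (2%:Q / 3%:Q) \in farey n.
  rewrite mem_farey; have [_ ->] := @fracq_coprime 2 3 isT isT.
  by rewrite lez_nat (leq_trans _ n4).
pose i := index (1%:Q / 4%:Q) (farey n).
pose j := index (2%:Q / 3%:Q) (farey n).
have js : (j < size (farey n))%N by rewrite index_mem.
have is_ : (i < size (farey n))%N by rewrite index_mem.
have ij : (i < j)%N.
  by rewrite -(lt_sorted_ltn_nth 0 (farey_sorted n)) ?inE // !nth_index.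
have oij : opp_ordered n i j.
  rewrite /opp_ordered /farey_num /farey_den !nth_index //.
have lt : (farey_gap n < size (farey n))%N.
  apply: leq_ltn_trans (lb i j _ oij) _; first by rewrite ij.
  by rewrite -subnDA (leq_ltn_trans (leq_subr _ _) js).
suff : farey_gap n = size (farey n) \/
    (exists i j : nat, [/\ (i < j < size (farey n))%N, opp_ordered n i j
                       & farey_gap n = (j - i - 1)%N]).
  by case=> // e; move: lt; rewrite e ltnn.
rewrite /farey_gap.
elim/big_ind: _ => [|x y hx hy|[a b] /andP[/= ab oab]]; first by left.
  by rewrite /minn; case: ifP.
by right; exists a, b; rewrite ab ltn_ord.
Qed.

(* Main.v *)
Require Import Defs.
From mathcomp Require Import all_boot all_order all_algebra.
From mathcomp Require Import zify ring lra.

(* If a/b < c/d are oppositely ordered then c >= a + 1 and d <= b - 1, so the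
   interval (a/b, c/d) contains an interval of length (1 + a/b) / n starting at
   a/b, and Farey fractions have to be counted in such intervals.

   Let p/q be a Dirichlet approximation of a/b with q <= sqrt n.  The fractions
   v/u with q v - p u = t lie at distance t / (q u) from p/q, and they correspond
   to the integers coprime to t in some interval.  Summing over t, an interval
   [p/q + x / (q n), p/q + y / (q n)] contains (n / q) * (integral over [x, y] of
   Phi(|s|) / s^2) + o(n) fractions, where Phi(s) is the sum of the totients of
   the integers up to s.  Here y - x = q (1 + a/b).  Sieving coprime pairs gives
   Phi(s) >= 63/250 s^2 for large s, and on every unit interval of [1, oo) the
   integral is at least 63/250 > 1/4; the integrand vanishes on (-1, 1).  So the
   count exceeds (1/4 + eps) n unless p/q = 1/2 and a/b < 1/2 < c/d.

   In that last case the fractions (u -+ 1) / (2 u) with u odd suffice.  The best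
   pairs are (2m)/(4m+1), (2m+1)/(4m), and (2m-1)/(4m), (2m)/(4m-1) when 4
   divides n. *)

Set Implicit Arguments.
Unset Strict Implicit.
Unset Printing Implicit Defensive.
Import Order.TTheory GRing.Theory Num.Theory.

(** * Sums of Euler's totient function *)

Definition totient_sum (m : nat) : nat := \sum_(1 <= t < m.+1) totient t.

Lemma totient_sumS (m : nat) :
  totient_sum m.+1 = totient_sum m + totient m.+1.
Proof. by rewrite /totient_sum big_nat_recr. Qed.

Lemma leq_totient (m : nat) : totient m <= m.
Proof.
rewrite totient_count_coprime -[leqRHS]muln1 -[m in leqRHS]subn0 -sum_nat_const_nat.
by apply: leq_sum => i _; case: coprime.
Qed.

Lemma sum_dvdn (d m : nat) : 0 < d -> \sum_(1 <= a < m.+1) (d %| a) = m %/ d.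
Proof.
move=> d0; elim: m => [|m IHm]; first by rewrite big_geq // div0n.
by rewrite big_nat_recr //= IHm divnS // addnC.
Qed.

Lemma totient_count_coprime1 (m : nat) : 0 < m ->
  totient m = \sum_(1 <= b < m.+1) coprime m b.
Proof.
case: m => // m _; rewrite totient_count_coprime big_ltn // [RHS]big_nat_recr //=.
by rewrite /coprime gcdn0 gcdnn addnC.
Qed.

(** The diagonal cuts the square into two closed triangles, each with [totient_sum m] coprime pairs;
    they share only the coprime pair (1, 1), whence the [+ 1]. *)
Lemma coprime_square (m : nat) : 0 < m ->
  \sum_(1 <= a < m.+1) \sum_(1 <= b < m.+1) coprime a b + 1 = 2 * totient_sum m.
Proof.
elim: m => // -[_ _|m IHm _]; first by rewrite /totient_sum !big_nat1.
have split_last : \sum_(1 <= a < m.+3) \sum_(1 <= b < m.+3) coprime a b =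
    \sum_(1 <= a < m.+2) \sum_(1 <= b < m.+2) coprime a b +
    \sum_(1 <= a < m.+2) coprime a m.+2 + totient m.+2.
  rewrite big_nat_recr //= -totient_count_coprime1 //; congr (_ + _).
  by rewrite -big_split /=; apply: eq_bigr => a _; rewrite big_nat_recr.
have last_col : \sum_(1 <= a < m.+2) coprime a m.+2 = totient m.+2.
  rewrite totient_count_coprime1 // [RHS]big_nat_recr //= [coprime m.+2 m.+2]/coprime.
  by rewrite gcdnn addn0; apply: eq_bigr => a _; rewrite coprime_sym.
by rewrite totient_sumS mulnDr -IHm // split_last last_col; lia.
Qed.

(** A superset of the primes up to [m]: the composite odd moduli weaken the sieve bound slightly,
    but let the sum of inverse squares be bounded by telescoping. *)
Definition sieve (m : nat) : seq nat :=
  [:: 2; 3; 5] ++ [seq k.*2.+1 | k <- iota 3 m].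

Lemma prime_sieve (p m : nat) : prime p -> p <= m -> p \in sieve m.
Proof.
move=> pp pm; rewrite mem_cat.
have [-> //|op] := even_prime pp.
have [p6|p6] := leqP p 6.
  by move: p pp p6 op {pm}; do 7?[case=> //].
apply/orP; right; apply/mapP; exists p./2; last first.
  by move: (odd_double_half p); rewrite op add1n.
by rewrite mem_iota; move: (odd_double_half p); rewrite op; lia.
Qed.

(** A pair that is not coprime has a common prime divisor in [sieve m], and exactly [(m %/ d) ^ 2]
    pairs have both entries divisible by [d]. *)
Lemma coprime_sieve (m : nat) : m ^ 2 <=
  \sum_(1 <= a < m.+1) \sum_(1 <= b < m.+1) coprime a b +
  \sum_(d <- sieve m) (m %/ d) ^ 2.
Proof.
have s0 d : d \in sieve m -> 0 < d.
  by rewrite mem_cat => /orP[|/mapP[k _ ->] //]; rewrite !inE => /or3P[] /eqP ->.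
have -> : \sum_(d <- sieve m) (m %/ d) ^ 2 =
    \sum_(1 <= a < m.+1) \sum_(1 <= b < m.+1)
      \sum_(d <- sieve m) (d %| a) * (d %| b).
  under [RHS]eq_bigr do rewrite exchange_big /=.
  rewrite exchange_big /= big_seq [RHS]big_seq; apply: eq_bigr => d ds.
  under eq_bigr do rewrite -big_distrr /=.
  by rewrite -big_distrl /= !sum_dvdn ?s0 //; lia.
rewrite -big_split /=.
under [X in _ <= X]eq_bigr do rewrite -big_split /=.
have -> : m ^ 2 = \sum_(1 <= a < m.+1) \sum_(1 <= b < m.+1) 1.
  by rewrite !sum_nat_const_nat; lia.
rewrite big_nat [leqRHS]big_nat; apply: leq_sum => a /andP[a0 am].
rewrite big_nat [leqRHS]big_nat; apply: leq_sum => b /andP[b0 bm].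
case: (boolP (coprime a b)) => //= nc.
have g1 : 1 < gcdn a b.
  by rewrite ltn_neqAle eq_sym nc gcdn_gt0 a0.
have pp := pdiv_prime g1.
have : pdiv (gcdn a b) %| gcdn a b by exact: pdiv_dvd.
rewrite dvdn_gcd => /andP[pa pb].
have ps : pdiv (gcdn a b) \in sieve m.
  by apply: prime_sieve => //; have := dvdn_leq a0 pa; lia.
by rewrite add0n (big_rem _ ps) /= pa pb.
Qed.

Local Open Scope ring_scope.

(** Telescoping: [1 / (2 k + 1)^2] is less than [(1 / k - 1 / (k + 1)) / 4]. *)
Lemma sum_odd_inv_sqr (m : nat) :
  \sum_(k <- iota 3 m) (k.*2.+1%:R ^- 2 : rat) <= 1/12 - 1 / (4 * (m + 3)%:R).
Proof.
elim: m => [|m IHm]; first by rewrite big_nil add0n; lra.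
have -> : iota 3 m.+1 = iota 3 m ++ [:: (3 + m)%N] by rewrite -[m.+1]addn1 iotaD.
rewrite big_cat /= big_seq1; apply: le_trans (lerD IHm (lexx _)) _.
have -> : (3 + m).*2.+1%:R = 2 * m%:R + 7 :> rat.
  by rewrite -addn1 -mul2n natrD natrM natrD; ring.
have m0 : 0 <= m%:R :> rat by [].
rewrite -[m.+1]addn1 !natrD; move: (m%:R) m0 => x x0.
rewrite -subr_ge0.
rewrite (_ : _ - _ = 1 / (4 * (x + 3) * (x + 4) * (2 * x + 7) ^+ 2)).
  by apply: divr_ge0 => //; rewrite !mulr_ge0 ?exprn_ge0 //; lra.
by field; apply/and3P; split; apply/eqP; lra.
Qed.

Lemma sum_sieve_inv_sqr (m : nat) :
  \sum_(d <- sieve m) (d%:R ^- 2 : rat) <= 1/4 + 1/9 + 1/25 + 1/12.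
Proof.
rewrite /sieve big_cat !big_cons big_nil big_map.
have := sum_odd_inv_sqr m; set s := \sum_(k <- _) _ => hs.
have p0 : 0 <= 1 / (4 * (m + 3)%:R) :> rat by rewrite divr_ge0 // mulr_ge0.
have e2 : 2%:R ^- 2 = 1 / 4 :> rat by [].
have e3 : 3%:R ^- 2 = 1 / 9 :> rat by [].
have e5 : 5%:R ^- 2 = 1 / 25 :> rat by [].
by rewrite e2 e3 e5 /=; clearbody s; lra.
Qed.

(** The coefficient is half of [1 - (1/4 + 1/9 + 1/25 + 1/12)], and [1/2] is half of the [+ 1] in
    [coprime_square]. *)
Lemma totient_sum_ge (m : nat) : (0 < m)%N ->
  464 / 1800 * m%:R ^+ 2 + 1/2 <= (totient_sum m)%:R :> rat.
Proof.
move=> m0; have := coprime_sieve m; have := coprime_square m0.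
set C := \sum_(1 <= a < m.+1) _ => eC; rewrite -(ler_nat rat) natrD natr_sum.
have {}eC : C%:R + 1 = 2 * (totient_sum m)%:R :> rat by rewrite -natrM -eC natrD.
have le1 d : ((m %/ d) ^ 2)%:R <= m%:R ^+ 2 * d%:R ^- 2 :> rat.
  rewrite natrX -exprVn -exprMn lerXn2r ?nnegrE ?divr_ge0 //.
  case: d => [|d]; first by rewrite invr0 mulr0 divn0.
  by rewrite ler_pdivlMr ?ltr0n // -natrM ler_nat leq_trunc_div.
have : \sum_(d <- sieve m) ((m %/ d) ^ 2)%:R
     <= \sum_(d <- sieve m) m%:R ^+ 2 * d%:R ^- 2 :> rat.
  by apply: ler_sum => d _.
rewrite -mulr_sumr => h1; rewrite natrX => h2.
have {}h1 := le_trans h1 (ler_wpM2l (exprn_ge0 2 (ler0n rat m)) (sum_sieve_inv_sqr m)).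
move: h1 h2 eC => {le1}; clearbody C.
move: (\sum_(d <- _) _) (m%:R ^+ 2) (totient_sum m)%:R C%:R.
by move=> S y phi c h1 h2 eC; lra.
Qed.

(** * The limit density *)

(* Any constant slightly larger than 1/4 works; it is locked because unification
   would otherwise compute with it. *)
Definition kappa : rat := locked (63 / 250).

Lemma kappaE : kappa = 63 / 250.
Proof. by rewrite /kappa -lock. Qed.

Lemma totient_sum_compute (m : nat) :
  totient_sum m = sumn [seq totient t | t <- iota 1 m].
Proof. by rewrite sumnE big_map /totient_sum /index_iota subSS subn0. Qed.

Lemma totient_sum_kappa_small :
  all (fun m => 250 + 63 * (m * m.+1) <=
                250 * sumn [seq totient t | t <- iota 1 m])%N (iota 5 59).
Proof. by vm_compute. Qed.

(** The sieve bound has a leading coefficient above [kappa], which absorbs the linear term from 64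
    on; smaller cases are computed. The summand 1 is slack for [totient_sum_step]. *)
Lemma totient_sum_ge_kappa (m : nat) : (5 <= m)%N ->
  1 + kappa * (m%:R * (m%:R + 1)) <= (totient_sum m)%:R.
Proof.
move=> m5; rewrite kappaE; have [m64|m64] := ltnP m 64.
  have hm : m \in iota 5 59 by rewrite mem_iota m5.
  have {hm} := allP totient_sum_kappa_small m hm; rewrite -totient_sum_compute.
  rewrite -(ler_nat rat) natrD !natrM -[m.+1]addn1 natrD.
  by move: m%:R (totient_sum m)%:R => x y ?; lra.
have m0 : (0 < m)%N by lia.
apply: le_trans (totient_sum_ge m0).
have : 64%:R <= m%:R :> rat by rewrite ler_nat.
by move: m%:R => x x64; nra.
Qed.

(* [hinge t x] is the proportion of [u <= n] with [t / u < x / n]. *)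
Definition hinge (t x : rat) : rat := if x <= t then 0 else 1 - t / x.

(* [hsum T x] is the integral of [totient_sum (floor s) / s ^ 2] over [s <= x],
   as long as [x <= T + 1]. *)
Definition hsum (T : nat) (x : rat) : rat :=
  \sum_(1 <= t < T.+1) (totient t)%:R / t%:R * hinge t%:R x.

Lemma hinge_ge0 (t x : rat) : 0 <= t -> 0 <= hinge t x.
Proof.
rewrite /hinge => t0; case: (leP x t) => // tx.
by rewrite subr_ge0 ler_pdivrMr ?mul1r ?ltW // (le_lt_trans t0).
Qed.

Lemma hinge_le1 (t x : rat) : 0 <= t -> hinge t x <= 1.
Proof.
rewrite /hinge => t0; case: (leP x t) => // tx.
by rewrite gerBl divr_ge0 // (le_trans t0) ?ltW.
Qed.

Lemma le_hinge (t x y : rat) : 0 <= t -> x <= y -> hinge t x <= hinge t y.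
Proof.
move=> t0 xy; have [xt|tx] := leP x t; first by rewrite {1}/hinge xt hinge_ge0.
have ty := lt_le_trans tx xy.
rewrite /hinge [x <= t]leNgt tx [y <= t]leNgt ty /= lerD2l lerN2 ler_wpM2l //.
by rewrite lef_pV2 ?posrE //; lra.
Qed.

Lemma le_hsum (T : nat) (x y : rat) : x <= y -> hsum T x <= hsum T y.
Proof.
by move=> xy; apply: ler_sum => t _; rewrite ler_wpM2l ?divr_ge0 // le_hinge.
Qed.

Lemma hsum_le1 (T : nat) (x : rat) : x <= 1 -> hsum T x = 0.
Proof.
move=> x1; rewrite /hsum big_nat big1 // => t /andP[t1 _].
by rewrite /hinge (le_trans x1) ?mulr0 // ler1n.
Qed.

(** The terms with [t > m] vanish up to and including [x = m + 1], so consecutive formulas overlap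
    at the integers. *)
Lemma hsumE (T m : nat) (x : rat) : (m <= T)%N -> m%:R <= x <= m%:R + 1 ->
  hsum T x = \sum_(1 <= t < m.+1) (totient t)%:R / t%:R - (totient_sum m)%:R / x.
Proof.
move=> mT /andP[mx xm]; rewrite /hsum (big_cat_nat _ (n := m.+1)) //=.
rewrite [X in _ + X]big_nat [X in _ + X]big1 ?addr0; last first.
  move=> t /andP[mt _]; rewrite /hinge ifT ?mulr0 //.
  by rewrite (le_trans xm) // natr1 ler_nat.
rewrite /totient_sum natr_sum mulr_suml -sumrB big_nat [RHS]big_nat.
apply: eq_bigr => t /andP[t1 tm].
have t0 : t%:R != 0 :> rat by rewrite pnatr_eq0; lia.
have x0 : x != 0.
  by apply/eqP => x0; move: mx; rewrite x0 lern0 -leqn0 => ?; lia.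
rewrite /hinge; case: (leP x t%:R) => [xt|tx]; last by field; rewrite x0.
have -> : x = t%:R.
  by apply/le_anti/andP; split=> //; apply: le_trans mx; rewrite ler_nat.
by field.
Qed.

Lemma kappa_ge0 : 0 <= kappa.
Proof. by rewrite kappaE; lra. Qed.

(** This is [hsum T (x + 1) - hsum T x >= kappa] multiplied by [x * (x + 1)]. The left side is
    convex, hence below its chord, and [x * (x - m) >= m * (x - m)] bounds the right side below by a
    linear function, so the endpoint inequalities [A] and [B] suffice. *)
Lemma totient_sum_step (m : nat) (x : rat) : (0 < m)%N ->
  m%:R <= x <= m%:R + 1 ->
  kappa * (x * (x + 1)) <=
  (totient_sum m)%:R + (totient m.+1)%:R * (x * (x - m%:R)) / (m%:R + 1).
Proof.
move=> m0 /andP[mx xm].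
(* For [m = 1] the inequality [B] fails, since [6 * kappa > 3 / 2]; a square replaces the chord
   argument. *)
have [m1|m2] : m = 1%N \/ (2 <= m)%N by lia.
  have -> : totient_sum m = 1%N by rewrite totient_sum_compute m1.
  have -> : totient m.+1 = 1%N by rewrite m1.
  have : 0 <= (x - 3 / 2) * (x - 3 / 2) by rewrite -expr2 sqr_ge0.
  have -> : (1%:R : rat) * (x * (x - m%:R)) / (m%:R + 1) = (x * x - x) / 2.
    by rewrite m1; field.
  by rewrite m1 in xm; rewrite kappaE; lra.
have small : (m < 5)%N ->
    [\/ [/\ m = 2, totient_sum m = 2 & totient m.+1 = 2],
        [/\ m = 3, totient_sum m = 4 & totient m.+1 = 2] |
        [/\ m = 4, totient_sum m = 6 & totient m.+1 = 4]]%N.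
  rewrite totient_sum_compute => m5.
  have : m \in [:: 2; 3; 4]%N by rewrite !inE; lia.
  by rewrite !inE => /or3P[] /eqP ->; [apply: Or31|apply: Or32|apply: Or33].
have A : kappa * (m%:R * (m%:R + 1)) <= (totient_sum m)%:R.
  have [m5|m5] := leqP 5 m.
    by apply: le_trans (totient_sum_ge_kappa m5); rewrite lerDr.
  by case: (small m5) => -[-> -> _]; rewrite kappaE; lra.
(* The factor [m / (m + 1)] lowers [totient m.+1] by at most 1, which is the slack of
   [totient_sum_ge_kappa]. *)
have B : kappa * ((m%:R + 1) * (m%:R + 2)) <=
    (totient_sum m)%:R + (totient m.+1)%:R * m%:R / (m%:R + 1).
  have [m5|m5] := leqP 5 m.
    have := totient_sum_ge_kappa (leqW m5); rewrite totient_sumS natrD -natr1.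
    have : (totient m.+1)%:R <= m%:R + 1 :> rat by rewrite natr1 ler_nat leq_totient.
    have : 2%:R <= m%:R :> rat by rewrite ler_nat.
    move: (totient_sum m)%:R (totient m.+1)%:R (m%:R : rat) => P f M M2 fM.
    have -> : f * M / (M + 1) = f - f / (M + 1) by field; apply/eqP; lra.
    have : f / (M + 1) <= 1 by rewrite ler_pdivrMr; lra.
    have -> : (M + 1) * (M + 1 + 1) = (M + 1) * (M + 2) by ring.
    by move: (f / _) (kappa * _) => a b; lra.
  case: (small m5) => -[-> -> ->].
  - have -> : (2%:R * 2%:R / (2%:R + 1) : rat) = 4 / 3 by field.
    by rewrite kappaE; lra.
  - have -> : (2%:R * 3%:R / (3%:R + 1) : rat) = 3 / 2 by field.
    by rewrite kappaE; lra.
  - have -> : (4%:R * 4%:R / (4%:R + 1) : rat) = 16 / 5 by field.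
    by rewrite kappaE; lra.
have M2 : 2%:R <= m%:R :> rat by rewrite ler_nat.
have : 0 <= (totient m.+1)%:R / (m%:R + 1) :> rat by rewrite divr_ge0 // addr_ge0.
move: A B; rewrite [_ * m%:R / _]mulrAC [_ * (x * _) / _]mulrAC kappaE.
move: (_ / (m%:R + 1)) => g.
move: (totient_sum m)%:R (m%:R : rat) mx xm M2 => P M mx xm M2 A B g0.
have h1 : 0 <= (M + 1 - x) * (P - 63 / 250 * (M * (M + 1))).
  by apply: mulr_ge0; lra.
have h2 : 0 <= (x - M) * (P + g * M - 63 / 250 * ((M + 1) * (M + 2))).
  by apply: mulr_ge0; lra.
have h3 : 0 <= g * ((x - M) * (x - M)) by apply: (mulr_ge0 g0); rewrite -expr2 sqr_ge0.
have h4 : 0 <= (x - M) * (M + 1 - x) by apply: mulr_ge0; rewrite subr_ge0.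
by lra.
Qed.

Lemma hsum_step (T : nat) (x : rat) : 1 <= x -> x + 1 <= T%:R ->
  hsum T x + kappa <= hsum T (x + 1).
Proof.
move=> x1 xT; have x0 : 0 <= x by lra.
have /andP[mx] := truncn_itv x0; set m := Num.Def.truncn x in mx *.
rewrite -natr1 => xm.
have m0 : (0 < m)%N by rewrite -(ltr_nat rat); lra.
have mT : (m.+1 <= T)%N by rewrite -(ler_nat rat) -natr1; lra.
rewrite (@hsumE T m x) ?(ltnW mT) ?mx ?(ltW xm) // (@hsumE T m.+1) //; last first.
  by rewrite -natr1; apply/andP; split; lra.
rewrite (big_nat_recr m.+1) //= totient_sumS.
have mxm : m%:R <= x <= m%:R + 1 by rewrite mx ltW.
have := totient_sum_step m0 mxm.
have M0 : 1 <= m%:R :> rat by rewrite ler1n.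
rewrite natrD -[m.+1%:R]natr1; move: (\sum_(_ <= _ < _) _ : rat) => S.
move: (totient_sum m)%:R (totient m.+1)%:R (m%:R) M0 mx xm {mxm} => P f M M0 mx xm h.
have xx0 : 0 < x * (x + 1) by rewrite mulr_gt0; lra.
have {}h : kappa <= (P + f * (x * (x - M)) / (M + 1)) / (x * (x + 1)).
  by rewrite ler_pdivlMr.
suff <- : S - P / x + (P + f * (x * (x - M)) / (M + 1)) / (x * (x + 1)) =
     S + f / (M + 1) - (P + f) / (x + 1) by move: (_ / _) h => a h; lra.
by field; apply/and3P; split; apply/eqP; lra.
Qed.

Lemma hsum_steps (T j : nat) (x : rat) : 1 <= x -> x + j%:R <= T%:R ->
  hsum T x + kappa * j%:R <= hsum T (x + j%:R).
Proof.
elim: j => [|j IHj] x1; first by rewrite mulr0 !addr0.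
rewrite -natr1 => xT; have j0 : 0 <= j%:R :> rat by [].
have h1 : hsum T x + kappa * j%:R <= hsum T (x + j%:R) by apply: IHj => //; lra.
have h2 : hsum T (x + j%:R) + kappa <= hsum T (x + j%:R + 1).
  by apply: hsum_step; lra.
by rewrite mulrDr mulr1 !addrA; apply: le_trans h2; rewrite lerD2r.
Qed.

(** Whole unit steps fill [[x, y]] up to a remainder shorter than 1, where monotonicity suffices. *)
Lemma hsum_diff (T : nat) (x y : rat) : 1 <= x -> x <= y -> y <= T%:R ->
  kappa * (y - x - 1) <= hsum T y - hsum T x.
Proof.
move=> x1 xy yT; have yx : 0 <= y - x by lra.
have /andP[jx] := truncn_itv yx; set j := Num.Def.truncn _ in jx *.
rewrite -natr1 => xj.
have h1 : hsum T x + kappa * j%:R <= hsum T (x + j%:R) by apply: hsum_steps => //; lra.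
have h2 : hsum T (x + j%:R) <= hsum T y by apply: le_hsum; lra.
have h3 : kappa * (y - x - 1) <= kappa * j%:R by apply: (ler_wpM2l kappa_ge0); lra.
by lra.
Qed.

(** Each unit step raises [hsum] by at least [kappa], so a line of slope [kappa] below [hsum] on one
    unit interval stays below it. *)
Lemma hsum_extend (T : nat) (r c : rat) : 1 <= r ->
  (forall x, r <= x <= r + 1 -> kappa * x + c <= hsum T x) ->
  forall x, r <= x -> x <= T%:R -> kappa * x + c <= hsum T x.
Proof.
move=> r1 h x rx xT; have xr : 0 <= x - r by lra.
have /andP[jx] := truncn_itv xr; set j := Num.Def.truncn _ in jx *.
rewrite -natr1 => xj.
have h1 : kappa * (x - j%:R) + c <= hsum T (x - j%:R).
  by apply: h; apply/andP; split; lra.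
have h2 : hsum T (x - j%:R) + kappa * j%:R <= hsum T (x - j%:R + j%:R).
  by apply: hsum_steps; lra.
by rewrite subrK in h2; lra.
Qed.

Lemma sum_totient_div :
  [/\ \sum_(1 <= t < 2) (totient t)%:R / t%:R = 1 :> rat,
      \sum_(1 <= t < 3) (totient t)%:R / t%:R = 3 / 2 :> rat &
      \sum_(1 <= t < 4) (totient t)%:R / t%:R = 13 / 6 :> rat].
Proof.
rewrite !(big_nat_recr 3) // !(big_nat_recr 2) // big_nat1.
have -> : totient 1 = 1%N by [].
have -> : totient 2 = 1%N by [].
have -> : totient 3 = 2%N by [].
by split; rewrite /=; lra.
Qed.

Lemma hsum12 (T : nat) (x : rat) : (4 <= T)%N -> 1 <= x <= 2 ->
  hsum T x = 1 - 1 / x.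
Proof.
move=> T4 /andP[x1 x2]; have [s1 _ _] := sum_totient_div.
rewrite (@hsumE T 1) ?s1 ?totient_sum_compute //; last by apply/andP; split; lra.
by lia.
Qed.

Lemma hsum23 (T : nat) (x : rat) : (4 <= T)%N -> 2 <= x <= 3 ->
  hsum T x = 3 / 2 - 2 / x.
Proof.
move=> T4 /andP[x1 x2]; have [_ s1 _] := sum_totient_div.
rewrite (@hsumE T 2) ?s1 ?totient_sum_compute //; last by apply/andP; split; lra.
by lia.
Qed.

Lemma hsum34 (T : nat) (x : rat) : (4 <= T)%N -> 3 <= x <= 4 ->
  hsum T x = 13 / 6 - 4 / x.
Proof.
move=> T4 /andP[x1 x2]; have [_ _ s1] := sum_totient_div.
rewrite (@hsumE T 3) ?s1 ?totient_sum_compute //; last by apply/andP; split; lra.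
by lia.
Qed.

(** Convexity of the inverse: the right side is the chord over [[l, u]]. It makes the bounds on
    [hsum] linear. *)
Lemma inv_chord (l u y : rat) : 0 < l -> l <= y <= u ->
  y^-1 <= (l + u - y) / (l * u).
Proof.
move=> l0 /andP[ly yu]; have y0 : 0 < y by lra.
have u0 : 0 < u by lra.
rewrite ler_pdivlMr ?mulr_gt0 // mulrC ler_pdivrMr // -subr_ge0.
have -> : (l + u - y) * y - l * u = (y - l) * (u - y) by ring.
by rewrite mulr_ge0 ?subr_ge0.
Qed.

(** The three lines of slope [kappa] in [hsum_ge1], [hsum_ge14] and [hsum_ge25] trade a later start
    for a larger intercept; [hsum_gap] combines them. *)
Lemma hsum_ge1 (T : nat) (x : rat) : (4 <= T)%N -> x <= T%:R ->
  kappa * (x - 1) <= hsum T x.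
Proof.
move=> T4 xT; have [x1|x1] := leP x 1.
  by rewrite hsum_le1 // kappaE; lra.
have -> : kappa * (x - 1) = kappa * x - kappa by ring.
apply: (@hsum_extend T 1) => //; last exact: ltW.
move=> y /andP[y1 y2]; rewrite hsum12 ?y1 //.
have := @inv_chord 1 2 y ltr01; rewrite y1 y2 => /(_ isT).
by rewrite mul1r kappaE; move: (y^-1) => z; lra.
Qed.

Lemma hsum_ge14 (T : nat) (x : rat) : (4 <= T)%N -> 7 / 5 <= x -> x <= T%:R ->
  kappa * x - 1 / 10 <= hsum T x.
Proof.
move=> T4; apply: (@hsum_extend T (7 / 5) (- (1 / 10))); first by lra.
move=> y /andP[y1 y2]; rewrite kappaE; have [y3|y3] := leP y 2.
  rewrite (@hsum12 T y T4); last by apply/andP; split; lra.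
  have := @inv_chord (7 / 5) 2 y; rewrite y1 y3 => h.
  have {}h : y^-1 <= (7 / 5 + 2 - y) / (7 / 5 * 2) by apply: h; lra.
  by rewrite mul1r; move: (y^-1) h => z; lra.
rewrite (@hsum23 T y T4); last by apply/andP; split; lra.
have h : y^-1 <= (2 + 3 - y) / (2 * 3).
  by apply: inv_chord; last apply/andP; try split; lra.
by move: (y^-1) h => z; lra.
Qed.

Lemma hsum_ge25 (T : nat) (x : rat) : (4 <= T)%N -> 5 / 2 <= x -> x <= T%:R ->
  kappa * x + 1 / 20 <= hsum T x.
Proof.
move=> T4; apply: (@hsum_extend T (5 / 2) (1 / 20)); first by lra.
move=> y /andP[y1 y2]; rewrite kappaE; have [y3|y3] := leP y 3.
  rewrite (@hsum23 T y T4); last by apply/andP; split; lra.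
  have h : y^-1 <= (5 / 2 + 3 - y) / (5 / 2 * 3).
    by apply: inv_chord; last apply/andP; try split; lra.
  by move: (y^-1) h => z; lra.
rewrite (@hsum34 T y T4); last by apply/andP; split; lra.
have h : y^-1 <= (3 + 4 - y) / (3 * 4).
  by apply: inv_chord; last apply/andP; try split; lra.
by move: (y^-1) h => z; lra.
Qed.

(* For [x < 0 < y] the point [s = 0], where the integrand vanishes, lies inside
   the interval; there a length of almost [4] is needed. *)
Lemma hsum_gap (T : nat) (x y : rat) : (4 <= T)%N -> - T%:R <= x -> x <= y ->
    y <= T%:R -> (x < 0 < y -> 39 / 10 <= y - x) ->
  kappa * (y - x - 1) <= hsum T y - hsum T x + (hsum T (- x) - hsum T (- y)).
Proof.
move=> T4 Tx xy yT; have [x0|x0] := leP 0 x => [_|].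
  rewrite [hsum T (- x)]hsum_le1 ?[hsum T (- y)]hsum_le1 ?subr0 ?addr0; try lra.
  have [x1|x1] := leP 1 x; first exact: hsum_diff.
  rewrite [hsum T x]hsum_le1 ?(ltW x1) // subr0.
  apply: le_trans (hsum_ge1 T4 yT); apply: (ler_wpM2l kappa_ge0); lra.
have [y0|y0] := leP y 0 => [_|].
  rewrite [hsum T x]hsum_le1 ?[hsum T y]hsum_le1 ?subr0 ?add0r; try lra.
  have -> : y - x - 1 = - x - - y - 1 by ring.
  have [y1|y1] := leP 1 (- y); first by apply: hsum_diff; lra.
  rewrite [hsum T (- y)]hsum_le1 ?(ltW y1) // subr0.
  have xT : - x <= T%:R by lra.
  apply: le_trans (hsum_ge1 T4 xT); apply: (ler_wpM2l kappa_ge0); lra.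
move=> /(_ isT) xy4; have xT : - x <= T%:R by lra.
rewrite [hsum T x]hsum_le1 ?[hsum T (- y)]hsum_le1 ?subr0; try lra.
have hx := hsum_ge1 T4 xT; have hy := hsum_ge1 T4 yT.
(* If one of the arms [y] and [- x] reaches [5 / 2], the bound [hsum_ge25] for it and [hsum_ge1] for
   the other suffice. *)
have k := kappaE; have [y2|y2] := leP (5 / 2) y.
  have := hsum_ge25 T4 y2 yT; move: hx; rewrite kappaE; lra.
have [x2|x2] := leP (5 / 2) (- x).
  have := hsum_ge25 T4 x2 xT; move: hy; rewrite kappaE; lra.
(* Both arms are shorter than [5 / 2], so each is at least [39 / 10 - 5 / 2 = 7 / 5]; two losses of
   [1 / 10] stay below [kappa]. *)
have y3 : 7 / 5 <= y by lra.
have x3 : 7 / 5 <= - x by lra.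
have := hsum_ge14 T4 x3 xT; have := hsum_ge14 T4 y3 yT.
by rewrite kappaE; lra.
Qed.

(** * Counting integers coprime to t in an interval *)

Lemma sum_dvdn_mul (d : nat) (f : nat -> nat) (x : nat) : (0 < d)%N ->
  (\sum_(1 <= s < x.+1) (d %| s) * f s = \sum_(1 <= s < (x %/ d).+1) f (d * s))%N.
Proof.
move=> d0; elim: x => [|x IHx]; first by rewrite div0n !big_geq.
rewrite big_nat_recr //= IHx divnS //; case: (boolP (d %| x.+1)%N) => dx.
  rewrite mul1n add1n [RHS]big_nat_recr //=; congr (_ + f _)%N.
  have <- : (x.+1 %/ d = (x %/ d).+1)%N by rewrite divnS // dx.
  by rewrite mulnC divnK.
by rewrite mul0n addn0 add0n.
Qed.

Definition sifted (P : seq nat) (x : nat) : nat :=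
  (\sum_(1 <= s < x.+1) all (fun p => ~~ (p %| s)) P)%N.

Definition sift_density (P : seq nat) : rat := \prod_(p <- P) (1 - p%:R^-1).

(** The multiples of [p] that survive [P] are the [p * s] with [s] surviving [P], as [p] is a prime
    distinct from those in [P]. *)
Lemma sifted_cons (p : nat) (P : seq nat) (x : nat) :
  all prime (p :: P) -> p \notin P ->
  (sifted P x = sifted (p :: P) x + sifted P (x %/ p))%N.
Proof.
move=> /= /andP[pp /allP primeP] pP; rewrite /sifted.
have -> : (\sum_(1 <= s < (x %/ p).+1) all (fun q => ~~ (q %| s)) P =
    \sum_(1 <= s < x.+1) (p %| s) * all (fun q => ~~ (q %| s)) P)%N.
  rewrite sum_dvdn_mul ?prime_gt0 //; apply: eq_bigr => s _; congr nat_of_bool.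
  apply: eq_in_all => q qP; rewrite Euclid_dvdM ?(primeP q qP) //.
  rewrite [(q %| p)%N]dvdn_prime2 ?(primeP q qP) //.
  by have /negbTE -> : q != p by apply: contraNneq pP => qp; rewrite -qp.
rewrite -big_split /=; apply: eq_bigr => s _.
by case: (p %| s)%N; rewrite /= ?mul1n ?mul0n ?addn0.
Qed.

Lemma sift_density_bounds (P : seq nat) : all prime P ->
  0 <= sift_density P <= 1.
Proof.
rewrite /sift_density; elim: P => [|p P IHP]; first by rewrite big_nil lexx ler01.
move=> /= /andP[pp /IHP /andP[d0 d1]]; rewrite big_cons.
have p1 : 0 <= (p%:R : rat)^-1 <= 1.
  by rewrite invr_ge0 ler0n invf_le1 ?ltr0n ?ler1n prime_gt0.
have /andP[p2 p3] := p1; rewrite mulr_ge0 ?subr_ge0 //=.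
by apply: mulr_ile1 => //; rewrite ?subr_ge0 // gerBl.
Qed.

(* Legendre's sieve: each prime doubles the error and adds a rounding error. *)
Lemma sifted_density (P : seq nat) (x : nat) : all prime P -> uniq P ->
  `|(sifted P x)%:R - sift_density P * x%:R| <= (2 ^ size P)%:R - 1.
Proof.
elim: P x => [|p P IHP] x.
  rewrite /sifted /sift_density big_nil /= sum_nat_const_nat mul1r subSS subn0 muln1.
  by rewrite subrr normr0.
move=> primeP /= /andP[pP uP].
have /= /andP[pp primeP'] := primeP.
have h1 := IHP x primeP' uP; have h2 := IHP (x %/ p)%N primeP' uP.
have e : (sifted P x)%:R = (sifted (p :: P) x)%:R + (sifted P (x %/ p))%:R :> rat.
  by rewrite (sifted_cons x primeP pP) natrD.
have /andP[d0 d1] := sift_density_bounds primeP'.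
have p0 : 0 < p%:R :> rat by rewrite ltr0n prime_gt0.
have lo : (x %/ p)%:R <= p%:R^-1 * x%:R :> rat.
  by rewrite ler_pdivlMl // -natrM ler_nat mulnC leq_trunc_div.
have hi : p%:R^-1 * x%:R <= (x %/ p)%:R + 1 :> rat.
  by rewrite ler_pdivrMl // natr1 -natrM ler_nat mulnC ltnW // ltn_ceil // prime_gt0.
rewrite {1}/sift_density big_cons -/(sift_density P) expnS mul2n -addnn natrD.
move: (sift_density P) d0 d1 h1 h2 => D d0 d1.
have m1 : 0 <= D * (p%:R^-1 * x%:R - (x %/ p)%:R) by rewrite mulr_ge0 ?subr_ge0.
have m2 : D * (p%:R^-1 * x%:R - (x %/ p)%:R) <= 1 by apply: mulr_ile1; lra.
rewrite !ler_norml => /andP[h1 h1'] /andP[h2 h2'].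
by apply/andP; split; lra.
Qed.

Lemma coprime_all_primes (t s : nat) : (0 < t)%N -> (0 < s)%N ->
  coprime t s = all (fun p => ~~ (p %| s)%N) (primes t).
Proof.
move=> t0 s0; rewrite coprime_has_primes // has_sym -all_predC.
apply: eq_in_all => p; rewrite mem_primes /= => /and3P[pp _ _].
by rewrite mem_primes pp s0.
Qed.

(** Euler's product formula for the totient. *)
Lemma sift_density_primes (t : nat) : (0 < t)%N ->
  sift_density (primes t) = (totient t)%:R / t%:R.
Proof.
move=> t0; have tN0 : t%:R != 0 :> rat by rewrite pnatr_eq0 -lt0n.
apply: (mulIf tN0); rewrite divfK //.
have -> : t%:R = \prod_(p <- primes t) (p ^ logn p t)%:R :> rat.
  rewrite -natr_prod {1}[t in LHS]prod_prime_decomp //; congr _%:R.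
  by rewrite prime_decompE big_map.
rewrite /sift_density -big_split totientE // natr_prod big_seq [RHS]big_seq /=.
apply: eq_bigr => p; rewrite mem_primes => /and3P[pp _ pt].
have l0 : (0 < logn p t)%N by rewrite logn_gt0 mem_primes pp t0.
rewrite -{1}(prednK l0) expnS !natrM mulrA; congr (_ * _).
have p0 : p%:R != 0 :> rat by rewrite pnatr_eq0 -lt0n prime_gt0.
by rewrite mulrBl mul1r mulVf // -{1}(prednK (prime_gt0 pp)) -natr1 addrK.
Qed.

(** Every prime divisor from 5 on exceeds its factor 4; the primes 2 and 3 account for the 16. The
    sieve error for [t] is thus of the order of the square root of [t]. *)
Lemma exp_size_primes (t : nat) : (0 < t)%N -> ((2 ^ size (primes t)) ^ 2 <= 16 * t)%N.
Proof.
move=> t0; rewrite -expnM mulnC expnM -[(2 ^ 2)%N]/4%N.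
have le_prod (s : seq nat) : all (leq 4) s -> (4 ^ size s <= \prod_(p <- s) p)%N.
  elim: s => [|p s IHs] /=; first by rewrite big_nil.
  by move=> /andP[p4 /IHs hs]; rewrite expnS big_cons leq_mul.
have : (\prod_(p <- primes t | leq 4 p) p <= t)%N.
  rewrite {2}[t]prod_prime_decomp // prime_decompE big_map /= big_mkcond /=.
  rewrite big_seq [leqRHS]big_seq; apply: leq_prod => p.
  rewrite mem_primes => /and3P[pp _ pt].
  have l0 : (0 < logn p t)%N by rewrite logn_gt0 mem_primes pp t0.
  case: ifP => _; last by rewrite expn_gt0 prime_gt0.
  by rewrite -{1}[p]expn1 leq_exp2l ?prime_gt1.
rewrite -big_filter => le_t.
have := count_predC (leq 4) (primes t); rewrite -!size_filter => <-.
rewrite expnD mulnC; apply: leq_mul; last first.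
  by apply: leq_trans le_t; apply: le_prod; rewrite filter_all.
rewrite -[16%N]/(4 ^ 2)%N leq_exp2l //.
rewrite -[2%N]/(size [:: 2; 3]%N); apply: uniq_leq_size.
  by rewrite filter_uniq // primes_uniq.
move=> p; rewrite mem_filter mem_primes !inE => /and3P[/= p4 pp _].
by case: p pp p4 => [|[|[|[|]]]].
Qed.

Lemma coprime_itv (t lo hi : nat) : (0 < t)%N -> (lo <= hi)%N ->
  (totient t)%:R / t%:R * (hi%:R - lo%:R) - 2 * (2 ^ size (primes t))%:R <=
  (\sum_(lo.+1 <= s < hi.+1) coprime t s)%:R :> rat.
Proof.
move=> t0 lohi; rewrite -sift_density_primes //.
have cs x : (\sum_(1 <= s < x.+1) coprime t s = sifted (primes t) x)%N.
  rewrite /sifted big_nat [RHS]big_nat; apply: eq_bigr => s /andP[s0 _].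
  by rewrite coprime_all_primes.
have primeP : all prime (primes t).
  by apply/allP => p; rewrite mem_primes => /and3P[].
have := sifted_density hi primeP (primes_uniq t).
have := sifted_density lo primeP (primes_uniq t).
have : (sifted (primes t) hi)%:R = (sifted (primes t) lo)%:R +
    (\sum_(lo.+1 <= s < hi.+1) coprime t s)%:R :> rat.
  by rewrite -natrD -!cs -big_cat_nat.
move=> ->; rewrite !ler_norml => /andP[h1 h1'] /andP[h2 h2'].
by move: h1 h1' h2 h2'; rewrite mulrBr; lra.
Qed.

(** Rounding the endpoints to integers costs at most 1 in length, hence at most [totient t / t <= 1]
    in the count; the third copy of the power of 2 pays for it. *)
Lemma coprime_open_itv (t B : nat) (y z : rat) : (0 < t)%N -> 0 <= y ->
  z <= B%:R ->
  (totient t)%:R / t%:R * (z - y) - 3 * (2 ^ size (primes t))%:R <=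
  (count (fun s => (y < s%:R < z) && coprime t s) (iota 0 B))%:R.
Proof.
move=> t0 y0 zB.
have r0 : 0 <= (totient t)%:R / t%:R :> rat by rewrite divr_ge0.
have r1 : (totient t)%:R / t%:R <= 1 :> rat.
  by rewrite ler_pdivrMr ?ltr0n // mul1r ler_nat leq_totient.
have e0 : 1 <= (2 ^ size (primes t))%:R :> rat by rewrite ler1n expn_gt0.
have c0 : 0 <= (count (fun s => (y < s%:R < z) && coprime t s) (iota 0 B))%:R :> rat.
  by [].
have [zy|yz] := leP z y.
  have : (totient t)%:R / t%:R * (z - y) <= 0 by rewrite mulr_ge0_le0 // subr_le0.
  by lra.
(* The last integer strictly below [z], which is [z - 1] when [z] is an integer. *)
have [hi hiz zhi] : exists2 hi : nat, hi%:R < z & z <= hi%:R + 1.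
  have z0 : 0 <= z by lra.
  have /andP[k1 k2] := truncn_itv z0; set k := Num.Def.truncn z in k1 k2.
  have [kz|zk] := ltP k%:R z; first by exists k => //; rewrite natr1 ltW.
  have ek : z = k%:R by apply/le_anti/andP.
  have k0 : (0 < k)%N by rewrite -(ltr_nat rat) -ek; apply: le_lt_trans yz.
  exists k.-1; first by rewrite ek ltr_nat prednK.
  by rewrite natr1 prednK // ek.
have /andP[l1] := truncn_itv y0; set lo := Num.Def.truncn y in l1 *.
rewrite -natr1 => l2.
have lohi : (lo <= hi)%N by rewrite -ltnS -(ltr_nat rat) -natr1; lra.
have hB : (hi < B)%N by rewrite -(ltr_nat rat); apply: lt_le_trans zB.
have := coprime_itv t0 lohi; set S := (\sum_(_ <= _ < _) _)%N => hS.
have SB : (S <= count (fun s => (y < s%:R < z)%R && coprime t s) (iota 0 B))%N.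
  have eB : iota 0 B = index_iota 0 B by rewrite /index_iota subn0.
  rewrite -sum1_count eB.
  rewrite big_mkcond (big_cat_nat (leq0n lo.+1) (leq_ltn_trans lohi hB)).
  rewrite [X in (_ <= _ + X)%N](big_cat_nat (n := hi.+1) _ hB) ?ltnS //=.
  apply: leq_trans (leq_addl _ _); apply: leq_trans (leq_addr _ _).
  rewrite /S big_nat [leqRHS]big_nat; apply: leq_sum => s /andP[s1 s2].
  have ys : y < (s : nat)%:R by apply: lt_le_trans l2 _; rewrite natr1 ler_nat.
  have sz : (s : nat)%:R < z by apply: le_lt_trans hiz; rewrite ler_nat.
  by rewrite ys sz; case: coprime.
have {}SB : S%:R <= (count (fun s => (y < s%:R < z) && coprime t s) (iota 0 B))%:R :> rat.
  by rewrite ler_nat.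
have : (totient t)%:R / t%:R * (z - y) <=
    (totient t)%:R / t%:R * (hi%:R - lo%:R) + (totient t)%:R / t%:R.
  by rewrite -[X in _ <= _ + X]mulr1 -mulrDr; apply: ler_wpM2l => //; lra.
move: hS SB r1 e0 {c0 r0}; move: (count _ _) => c; clearbody S.
by move: (_ / t%:R) (2 ^ _)%:R => r E; lra.
Qed.

(** * Fractions near p / q *)

Lemma coprime_numq_denq (v u : int) : 0 < u -> coprimez v u ->
  numq (v%:~R / u%:~R) = v /\ denq (v%:~R / u%:~R) = u.
Proof.
move=> u0; rewrite coprimezE => c.
by rewrite coprimeq_num // coprimeq_den // gtr0_sg // mul1r gt_eqF // gtr0_norm.
Qed.

(** Reducing a Bezout coefficient modulo [q] bounds [q'], so that the shift [t q' / q] in the range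
    of [s] below is at most [t]. *)
Lemma bezout_unimodular (p : int) (q : nat) : (0 < q)%N -> coprimez p q ->
  exists2 q' : nat, (q' <= q)%N & exists p' : int, p * q' - q%:Z * p' = 1.
Proof.
move=> q0 cpq; have [a [b e]] := Bezoutz p q.
have {}e : a * p + b * q = 1 by rewrite e; apply/eqP.
have qN0 : q%:Z != 0 by rewrite eqz_nat -lt0n.
have m0 : 0 <= (a %% q)%Z by rewrite modz_ge0.
exists `|(a %% q)%Z|%N.
  by rewrite -lez_nat gez0_abs // ltW // ltz_pmod.
exists (- b - (a %/ q)%Z * p); rewrite gez0_abs //.
by move: (divz_eq a q) e; move: (a %/ q)%Z (a %% q)%Z => d m -> e; rewrite -e; ring.
Qed.

(* With [p q' - q p' = 1], the substitution [(u, v) = s (q, p) - t (q', p')]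
   maps coprime pairs [(s, t)] to reduced fractions [v / u] such that
   [v / u - p / q = t / (q u)]. *)
Lemma fractions_right_of (n q T : nat) (p : int) (A B E : rat) :
    (0 < n)%N -> (0 < q)%N -> coprimez p q -> A <= B ->
    (forall t, (0 < t <= T)%N -> 3 * (2 ^ size (primes t))%:R <= E) ->
  exists l : seq rat, [/\ uniq l,
    forall x, x \in l -> [/\ denq x <= n%:Z, 0 < x - p%:~R / q%:R &
                           A < (x - p%:~R / q%:R) * (q%:R * n%:R) < B] &
    n%:R / q%:R * (hsum T B - hsum T A) - T%:R * E <= (size l)%:R].
Proof.
move=> n0 q0 cpq AB hE; have [q' q'q [p' det]] := bezout_unimodular q0 cpq.
have qR : 0 < q%:R :> rat by rewrite ltr0n.
have nR : 0 < n%:R :> rat by rewrite ltr0n.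
(* The number [n * (1 - hinge t x)] is the smaller of [n] and [t n / x] if [x > 0], and [n]
   otherwise. For the denominator [u = s q - t q'], the bounds on [s] thus say [A < t n / u < B] and
   [u < n]. *)
pose y (t : nat) : rat := (n%:R * (1 - hinge t%:R B) + t%:R * q'%:R) / q%:R.
pose z (t : nat) : rat := (n%:R * (1 - hinge t%:R A) + t%:R * q'%:R) / q%:R.
pose sel t := [seq s <- iota 0 (n + T) | (y t < s%:R < z t) && coprime t s].
pose U (t s : nat) : int := s%:Z * q%:Z - t%:Z * q'%:Z.
pose V (t s : nat) : int := s%:Z * p - t%:Z * p'.
pose f t s : rat := (V t s)%:~R / (U t s)%:~R.
have detUV t s : q%:Z * V t s - p * U t s = t.
  by rewrite /U /V -[RHS]mulr1 -det; ring.
have boundU t s : s \in sel t ->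
    n%:R * (1 - hinge t%:R B) < ((U t s)%:~R : rat) < n%:R * (1 - hinge t%:R A).
  rewrite mem_filter => /andP[/andP[/andP[ys sz] _] _].
  rewrite /U rmorphB !rmorphM /= -!pmulrn.
  move: ys sz; rewrite /y /z ltr_pdivrMr // ltr_pdivlMr // => ys sz.
  by apply/andP; split; lra.
have U0 t s : s \in sel t -> 0 < U t s.
  move=> /boundU /andP[h _]; rewrite -(ltr0z rat); apply: le_lt_trans h.
  by rewrite mulr_ge0 ?(ltW nR) // subr_ge0 hinge_le1.
have copUV t s : s \in sel t -> coprimez (V t s) (U t s).
  rewrite mem_filter => /andP[/andP[_ cts] _].
  (* The inverse substitution writes [t] and [s] as integer combinations of [U] and [V], which
     carries a Bezout relation over. *)
  have /coprimezP[[a b] /= e] : coprimez t s by [].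
  apply/coprimezP; exists (a * q%:Z + b * q'%:Z, - a * p - b * p') => /=.
  rewrite -e -[in RHS](detUV t s).
  have -> : s%:Z = q'%:Z * V t s - p' * U t s.
    by rewrite /U /V -[LHS]mulr1 -det; ring.
  by ring.
have fE t s : s \in sel t -> numq (f t s) = V t s /\ denq (f t s) = U t s.
  by move=> hs; apply: coprime_numq_denq; [exact: U0 | exact: copUV].
exists [seq f t s | t <- iota 1 T, s <- sel t]; split.
- apply: allpairs_uniq_dep; first exact: iota_uniq.
    by move=> t _; rewrite filter_uniq ?iota_uniq.
  move=> _ _ /allpairsPdep[t [s [_ + ->]]] /allpairsPdep[t2 [s2 [_ + ->]]] /=.
  move=> hs hs2 ef; have [e1 e2] := fE _ _ hs; have [e3 e4] := fE _ _ hs2.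
  rewrite ef e3 in e1; rewrite ef e4 in e2.
  have et : t = t2.
    by apply/eqP; rewrite -eqz_nat -(detUV t s) -(detUV t2 s2) e1 e2.
  suff -> : s = s2 by rewrite et.
  move: e2; rewrite et /U => /addIr /eqP.
  by rewrite -!PoszM eqz_nat eqn_pmul2r // => /eqP.
- move=> x /allpairsPdep[t [s [tT hs ->]]]; have [_ eU] := fE _ _ hs.
  have Ugt0 := U0 _ _ hs; have UR : 0 < (U t s)%:~R :> rat by rewrite ltr0z.
  have t0 : (0 < t)%N by move: tT; rewrite mem_iota => /andP[].
  have tR : 0 < t%:R :> rat by rewrite ltr0n.
  have /andP[UB UA] := boundU _ _ hs.
  have hA0 : 0 <= hinge t%:R A by apply: hinge_ge0.
  have Un : (U t s)%:~R < n%:R :> rat.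
    by apply: lt_le_trans UA _; rewrite -[leRHS]mulr1 ler_wpM2l ?(ltW nR) // gerBl.
  have ed : f t s - p%:~R / q%:R = t%:R / (q%:R * (U t s)%:~R).
    have -> : t%:R = q%:R * (V t s)%:~R - p%:~R * (U t s)%:~R :> rat.
      by have := congr1 (fun z : int => z%:~R : rat) (detUV t s); rewrite rmorphB !rmorphM.
    by rewrite /f; field; rewrite !gt_eqF.
  rewrite eU ed; split.
  + by rewrite -(ler_int rat) ltW.
  + by rewrite divr_gt0 // mulr_gt0.
  have -> : t%:R / (q%:R * (U t s)%:~R) * (q%:R * n%:R) = t%:R * n%:R / (U t s)%:~R :> rat.
    by field; rewrite !gt_eqF.
  rewrite ltr_pdivlMr // ltr_pdivrMr //; apply/andP; split.
    have [At|tA] := leP A t%:R.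
      apply: (@le_lt_trans _ _ (t%:R * (U t s)%:~R)); last by rewrite ltr_pM2l.
      by rewrite ler_pM2r.
    have A0 : 0 < A := lt_trans tR tA.
    move: UA; rewrite /hinge [A <= _]leNgt tA /=.
    have -> : n%:R * (1 - (1 - t%:R / A)) = t%:R * n%:R / A by ring.
    by rewrite ltr_pdivlMr // mulrC.
  have [Bt|tB] := leP B t%:R.
    by move: UB; rewrite /hinge Bt subr0 mulr1 => /(lt_trans Un); rewrite ltxx.
  have B0 : 0 < B := lt_trans tR tB.
  move: UB; rewrite /hinge [B <= _]leNgt tB /=.
  have -> : n%:R * (1 - (1 - t%:R / B)) = t%:R * n%:R / B by ring.
  by rewrite ltr_pdivrMr // [B * _]mulrC.
rewrite size_allpairs_dep sumnE big_map natr_sum.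
have -> : n%:R / q%:R * (hsum T B - hsum T A) - T%:R * E =
    \sum_(t <- iota 1 T) ((totient t)%:R / t%:R * (z t - y t) - E).
  rewrite sumrB; congr (_ - _); last first.
    by rewrite big_const_seq count_predT size_iota iter_addr addr0 mulr_natl.
  rewrite /hsum -sumrB mulr_sumr /index_iota subSS subn0; apply: eq_bigr => t _.
  have -> : z t - y t = n%:R / q%:R * (hinge t%:R B - hinge t%:R A).
    by rewrite /y /z; field; rewrite gt_eqF.
  by rewrite -mulrBr mulrCA.
rewrite big_seq [leRHS]big_seq; apply: ler_sum => t; rewrite mem_iota => /andP[t0 tT].
have {}tT : (t <= T)%N by rewrite -ltnS.
apply: le_trans (_ : (totient t)%:R / t%:R * (z t - y t) - 3 * (2 ^ size (primes t))%:R <= _).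
  by rewrite lerD2l lerN2 hE // t0.
rewrite /sel size_filter; apply: coprime_open_itv => //.
  by rewrite divr_ge0 // addr_ge0 ?mulr_ge0 // subr_ge0 hinge_le1.
rewrite /z ler_pdivrMr // natrD mulrDl; apply: lerD.
  apply: le_trans (_ : n%:R * 1 <= _).
    by rewrite ler_pM2l // gerBl hinge_ge0.
  by rewrite ler_pM2l // ler1n.
by rewrite -!natrM ler_nat leq_mul.
Qed.

(** The reflection of [x] to [- x] exchanges the two sides and replaces [p] by [- p]; this is why
    numerators are integers here. *)
Lemma fractions_left_of (n q T : nat) (p : int) (A B E : rat) :
    (0 < n)%N -> (0 < q)%N -> coprimez p q -> A <= B ->
    (forall t, (0 < t <= T)%N -> 3 * (2 ^ size (primes t))%:R <= E) ->
  exists l : seq rat, [/\ uniq l,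
    forall x, x \in l -> [/\ denq x <= n%:Z, x - p%:~R / q%:R < 0 &
                           A < (x - p%:~R / q%:R) * (q%:R * n%:R) < B] &
    n%:R / q%:R * (hsum T (- A) - hsum T (- B)) - T%:R * E <= (size l)%:R].
Proof.
move=> n0 q0 cpq AB hE.
have cpq' : coprimez (- p) q by rewrite coprimezE abszN -coprimezE.
have BA : - B <= - A by rewrite lerN2.
have [l [ul hl sl]] := fractions_right_of n0 q0 cpq' BA hE.
exists (map -%R l); split; last by rewrite size_map.
  by rewrite map_inj_uniq //; exact: oppr_inj.
move=> _ /mapP[x /hl + ->]; rewrite denqN.
have -> : - x - p%:~R / q%:R = - (x - (- p)%:~R / q%:R) :> rat.
  by rewrite rmorphN mulNr opprK opprD.
rewrite oppr_lt0 mulNr => -[h1 h2 /andP[h3 h4]]; split => //.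
by apply/andP; split; [rewrite ltrNr|rewrite ltrNl].
Qed.

(** * Dirichlet approximation and control of the error terms *)

Lemma dirichlet_approximation (x : rat) (N : nat) : 0 <= x -> (0 < N)%N ->
  exists p q : nat, [/\ (0 < q <= N)%N, coprime p q &
                        `|q%:R * x - p%:R| * N%:R <= 1].
Proof.
move=> x0 N0; pose r (k : nat) : rat := k%:R * x - (Num.Def.truncn (k%:R * x))%:R.
have kx0 (k : nat) : 0 <= k%:R * x by rewrite mulr_ge0.
have r01 k : 0 <= r k < 1.
  have /andP[] := truncn_itv (kx0 k); rewrite -natr1 /r => h1 h2.
  by apply/andP; split; lra.
have NR : 0 < N%:R :> rat by rewrite ltr0n.
have rN0 k : 0 <= N%:R * r k by have /andP[h _] := r01 k; rewrite mulr_ge0.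
have box_lt (k : nat) : (Num.Def.truncn (N%:R * r k) < N)%N.
  rewrite -(ltr_nat rat); have /andP[h _] := truncn_itv (rN0 k).
  apply: le_lt_trans h _; rewrite -[ltRHS]mulr1 ltr_pM2l //.
  by have /andP[] := r01 k.
(* Pigeonhole: the fractional parts of the [N + 1] multiples [k x] fall into [N] boxes of length
   [1 / N]. *)
pose box (k : 'I_N.+1) : 'I_N := Ordinal (box_lt k).
have /injectivePn[k1 [k2 k12 ebox]] : ~~ injectiveb box.
  apply/injectiveP => /leq_card; rewrite !card_ord.
  by rewrite ltnn.
wlog lt12 : k1 k2 k12 ebox / (k1 < k2)%N.
  move=> hw; have [lt|lt|e] := ltngtP k1 k2; first exact: (hw k1 k2).
    by apply: (hw k2 k1) => //; rewrite eq_sym.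
  by move: k12; rewrite -val_eqE /= e eqxx.
have {ebox} close : `|r k2 - r k1| * N%:R <= 1.
  have := congr1 val ebox => /= eb.
  have /andP[h1 h2] := truncn_itv (rN0 k1); have /andP[h3 h4] := truncn_itv (rN0 k2).
  move: h2 h4; rewrite -!natr1 -eb => h2 h4; rewrite -eb in h3.
  rewrite -[X in _ * X]gtr0_norm // -normrM ler_norml.
  by apply/andP; split; lra.
pose q0 := (k2 - k1)%N.
pose p0 := (Num.Def.truncn (k2%:R * x) - Num.Def.truncn (k1%:R * x))%N.
have tle : (Num.Def.truncn (k1%:R * x) <= Num.Def.truncn (k2%:R * x))%N.
  by rewrite le_truncn // ler_wpM2r // ler_nat ltnW.
have q00 : (0 < q0)%N by rewrite subn_gt0.
have e : q0%:R * x - p0%:R = r k2 - r k1.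
  by rewrite /q0 /p0 (natrB _ (ltnW lt12)) (natrB _ tle) /r; ring.
(* Passing to lowest terms divides the error by [g >= 1] and does not increase the denominator. *)
pose g := gcdn p0 q0; have g0 : (0 < g)%N by rewrite gcdn_gt0 q00 orbT.
exists (p0 %/ g)%N, (q0 %/ g)%N; split.
- rewrite divn_gt0 // dvdn_leq ?dvdn_gcdr //=.
  by apply: leq_trans (leq_div _ _) _; rewrite /q0; have := ltn_ord k2; lia.
- rewrite /coprime -(eqn_pmul2r g0) muln_gcdl !divnK ?dvdn_gcdl ?dvdn_gcdr //.
  by rewrite mul1n.
have gR : 1 <= g%:R :> rat by rewrite ler1n.
apply: le_trans close; rewrite ler_pM2r // -e.
have -> : q0%:R * x - p0%:R = g%:R * ((q0 %/ g)%:R * x - (p0 %/ g)%:R).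
  by rewrite mulrBr mulrA -!natrM ![(g * _)%N]mulnC !divnK ?dvdn_gcdl ?dvdn_gcdr.
by rewrite normrM ger0_norm // -[leLHS]mul1r ler_wpM2r.
Qed.

Lemma sqrt_floor (n : nat) : exists N : nat, (N ^ 2 <= n < N.+1 ^ 2)%N.
Proof.
elim: n => [|n [N /andP[h1 h2]]]; first by exists 0%N.
have [h|h] := ltnP n.+1 (N.+1 ^ 2); first by exists N; rewrite h leqW.
by exists N.+1; rewrite h /=; nia.
Qed.

(** With [N] and [R] near the square and fourth roots of [n], there are about [3 N] values of [t],
    each with an error of order [R]; the total is at most [192 n / R], which is o(n). *)
Lemma error_bound (n N R : nat) : (R ^ 2 <= N < R.+1 ^ 2)%N -> (N ^ 2 <= n)%N ->
  (2 <= R)%N ->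
  exists2 E : rat,
   forall t, (0 < t <= 3 * N + 2)%N -> 3 * (2 ^ size (primes t))%:R <= E &
   (3 * N + 2)%:R * E * R%:R <= 192 * n%:R.
Proof.
move=> /andP[RN NR] Nn R2; exists (3 * (8 * R.+1)%:R).
  move=> t /andP[t0 tT]; rewrite ler_pM2l // ler_nat.
  rewrite -leq_sqr; apply: leq_trans (exp_size_primes t0) _.
  by rewrite expnMn; nia.
rewrite -!natrM ler_nat.
by nia.
Qed.

(* In the coordinate (z - p/q) q n the points [x] and [x + (1 + x) / n] are [u]
   and [v]. *)
Lemma hsum_gap_near (n N p q T : nat) (x u v : rat) : (10 <= N)%N ->
    (0 < q <= N)%N -> coprime p q -> (3 * N + 2 <= T)%N ->
    `|q%:R * x - p%:R| * N%:R <= 1 -> `|n%:R * (q%:R * x - p%:R)| <= N%:R + 2 ->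
    0 < x -> 1 <= n%:R * x -> x + (1 + x) / n%:R <= 1 ->
    ~~ (x < 1 / 2 < x + (1 + x) / n%:R) ->
    u = n%:R * (q%:R * x - p%:R) -> v = u + q%:R * (1 + x) ->
  kappa * (q%:R - N%:R^-1) <=
  hsum T v - hsum T u + (hsum T (- u) - hsum T (- v)).
Proof.
move=> N10 /andP[q0 qN] cpq NT close uN x0 nx y1 nhalf eu ev.
have NR : 10 <= N%:R :> rat by rewrite ler_nat.
have qNR : q%:R <= N%:R :> rat by rewrite ler_nat.
have q1 : 1 <= q%:R :> rat by rewrite ler1n.
have nR : 0 < n%:R :> rat by case: n nx {uN y1 nhalf eu} => // h; exfalso; lra.
have n1 : 0 <= (1 + x) / n%:R by apply: divr_ge0 => //; lra.
have TR : 3 * N%:R + 2 <= T%:R :> rat by rewrite -natrM -natrD ler_nat.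
have {}close : `|q%:R * x - p%:R| <= N%:R^-1.
  by rewrite -[leRHS]mul1r ler_pdivlMr //; lra.
have N1 : N%:R^-1 <= 1 / 10 :> rat.
  by rewrite -[leLHS]mul1r ler_pdivrMr; lra.
have N0 : 0 <= N%:R^-1 :> rat by rewrite invr_ge0.
have x1 : x <= 1 by lra.
have qx : q%:R * x <= q%:R by rewrite ler_piMr //; lra.
move: close uN; rewrite -eu !ler_norml => /andP[c1 c2] /andP[u1 u2].
have ev' : v = n%:R * (q%:R * (x + (1 + x) / n%:R) - p%:R).
  by rewrite ev eu; field; rewrite gt_eqF.
have T4 : (4 <= T)%N by move: N10 NT; clear; lia.
(* For [p = 0] and [q = 1] the bound of [hsum_gap] is too weak; but then [u >= 1] and [v >= u + 1],
   so a single unit step suffices. *)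
have [p1|p1] := leqP p 0.
  have p0 : p = 0%N by apply/eqP; rewrite -leqn0.
  have q1' : q = 1%N by move: cpq; rewrite p0 /coprime gcd0n => /eqP.
  have eu' : u = n%:R * x by rewrite eu p0 q1' mul1r subr0.
  have v1 : u + 1 <= v by rewrite ev q1'; lra.
  have h1 : hsum T u + kappa <= hsum T (u + 1) by apply: hsum_step; lra.
  have h2 := le_hsum T v1.
  rewrite [hsum T (- u)]hsum_le1 ?[hsum T (- v)]hsum_le1; try lra.
  have h3 : kappa * (q%:R - N%:R^-1) <= kappa * 1.
    by apply: (ler_wpM2l kappa_ge0); rewrite q1'; lra.
  by lra.
have pR : 1 <= p%:R :> rat by rewrite ler1n.
have vu : v - u = q%:R * (1 + x) by rewrite ev; ring.
(* Here [q (1 + x) >= q + p - 1 / N], and [p >= 1] pays for the unit lost in [hsum_gap]. *)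
apply: le_trans (_ : kappa * (v - u - 1) <= _).
  by apply: (ler_wpM2l kappa_ge0); rewrite vu; lra.
have Tu : - T%:R <= u by lra.
have uv : u <= v by lra.
have vT : v <= T%:R by lra.
apply: (hsum_gap T4 Tu uv vT).
move=> /andP[u0 v0]; rewrite vu.
have qxp : q%:R * x < p%:R by move: u0; rewrite eu pmulr_rlt0 // subr_lt0.
have pqy : p%:R < q%:R * (x + (1 + x) / n%:R) by move: v0; rewrite ev' pmulr_rgt0 // subr_gt0.
(* For [q >= 3] the length is at least [3 + 1 - 1 / 10], the source of [39 / 10]. For smaller [q],
   the fraction [p / q] lies strictly between [x] and a number at most 1, so it is the excluded
   [1 / 2]. *)
have [q3|q3] := leqP 3 q.
  have : 3 <= q%:R :> rat by rewrite ler_nat.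
  by lra.
have pq : (p <= q)%N.
  have : p%:R < q%:R + 1 :> rat by lra.
  by rewrite natr1 ltr_nat.
have [q1'|q2] : q = 1%N \/ q = 2%N by move: q0 q3; clear; lia.
  have p1' : p = 1%N by move: pq p1; rewrite q1'; clear; lia.
  by move: pqy; rewrite q1' p1'; lra.
have p1' : p = 1%N by move: pq p1 cpq; rewrite q2; clear; move: p => [|[|[|]]].
by case/negP: nhalf; move: pqy qxp; rewrite p1' q2 => h1 h2; apply/andP; split; lra.
Qed.

(** The count is [kappa n] up to errors of order [n / R], with [R] near the fourth root of [n], and
    [kappa > 1 / 4]. The summand 4 matches [leq_U]. *)
Lemma many_fractions : exists N0 : nat, forall (n : nat) (x y : rat),
    (N0 <= n)%N -> 0 < x -> denq x <= n%:Z -> y <= 1 ->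
    x + (1 + x) / n%:R <= y -> ~~ (x < 1 / 2 < y) ->
  exists l : seq rat, [/\ uniq l, forall z, z \in l -> denq z <= n%:Z /\ x < z < y &
    n%:R / 4 + 4 <= (size l)%:R :> rat].
Proof.
(* [c] is kept abstract so that unification never computes with it. *)
have [c [ec [R0 hR0]]] : exists c : rat, c = 400 * (10 * 10 * 10) /\
    exists R0 : nat, c <= R0%:R.
  exists (400 * (10 * 10 * 10)); split=> //.
  by exists (400 * (10 * 10 * 10))%N; rewrite !natrM lexx.
(* A fourth power, so that [R >= R0 >= 400000]; then the loss [(2 * 192 + kappa) n / R] is below
   half of [(kappa - 1 / 4) n]. *)
exists ((R0 ^ 2) ^ 2)%N => n x y n0 x0 dx y1 xy nhalf.
have [N /andP[Nn nN]] := sqrt_floor n; have [R /andP[RN NR]] := sqrt_floor N.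
have RR0 : (R0 <= R)%N.
  have : (R0 ^ 2 <= N)%N.
    by rewrite -ltnS -ltn_sqr; apply: leq_ltn_trans nN.
  by move=> h; rewrite -ltnS -ltn_sqr; apply: leq_ltn_trans NR.
have {hR0}R_big : c <= R%:R.
  by apply: le_trans hR0 _; rewrite ler_nat.
have R10 : (10 <= R)%N by rewrite -(ler_nat rat); clear -ec R_big; lra.
have R_gt0 : (0 < R)%N by apply: leq_trans R10.
have RleN : (R <= N)%N by apply: leq_trans RN; rewrite leq_pmulr.
have N10 := leq_trans R10 RleN; have N_gt0 : (0 < N)%N by apply: leq_trans N10.
have Nlen : (N <= n)%N by apply: leq_trans Nn; rewrite leq_pmulr.
have n_gt0 : (0 < n)%N by apply: leq_trans Nlen.
have nR : 0 < n%:R :> rat by rewrite ltr0n.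
have N_R : 0 < N%:R :> rat by rewrite ltr0n.
have [p [q [/andP[q0 qN] cpq close]]] := dirichlet_approximation (ltW x0) N_gt0.
have qR : 1 <= q%:R :> rat by rewrite ler1n.
have nx : 1 <= n%:R * x.
  have dxR : (denq x)%:~R <= n%:R :> rat by rewrite -[n%:R]/((n%:Z)%:~R : rat) ler_int.
  have : 1 <= (denq x)%:~R * x.
    by rewrite mulrC -numqE -[1]/(1%:~R) ler_int -gtz0_ge1 numq_gt0.
  by move=> h; apply: le_trans h _; rewrite ler_pM2r.
have uN : `|n%:R * (q%:R * x - p%:R)| <= N%:R + 2.
  rewrite normrM (gtr0_norm nR) -(ler_pM2r N_R) -mulrA.
  apply: le_trans (_ : n%:R * 1 <= _); first by rewrite (ler_pM2l nR).
  by rewrite mulr1 -natrD -natrM ler_nat; move: nN; clear; nia.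
pose u := n%:R * (q%:R * x - p%:R); pose v := u + q%:R * (1 + x).
have nhalf' : ~~ (x < 1 / 2 < x + (1 + x) / n%:R).
  by apply: contra nhalf => /andP[-> h]; apply: lt_le_trans xy.
(* The cutoff [3 N + 2] covers [u] and [v]: the absolute value of [u] is at most [N + 2], and
   [v - u = q (1 + x)] is at most [2 N]. *)
have key : kappa * (q%:R - N%:R^-1) <= _ := @hsum_gap_near n N p q (3 * N + 2) x u v N10
   (introT andP (conj q0 qN)) cpq (leqnn _) close uN x0 nx (le_trans xy y1) nhalf' (erefl u) (erefl v).
have [E hE eE] := error_bound (introT andP (conj RN NR)) Nn (leq_trans (isT : 2 <= 10)%N R10).
have x1 : 0 <= 1 + x by rewrite addr_ge0 ?ler01 ?(ltW x0).
have uv : u <= v by rewrite lerDl; apply: mulr_ge0 x1.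
have cpq' : coprimez p%:Z q by [].
have [l1 [u1 h1 s1]] := fractions_right_of n_gt0 q0 cpq' uv hE.
have [l2 [u2 h2 s2]] := fractions_left_of n_gt0 q0 cpq' uv hE.
have qR0 : 0 < q%:R :> rat by rewrite ltr0n.
have qn0 : 0 < q%:R * n%:R :> rat by apply: mulr_gt0.
have in_xy (z : rat) : u < (z - p%:~R / q%:R) * (q%:R * n%:R) < v -> x < z < y.
  have -> : u = (x - p%:~R / q%:R) * (q%:R * n%:R).
    by rewrite /u -pmulrn; field; rewrite gt_eqF.
  have -> : v = (x + (1 + x) / n%:R - p%:~R / q%:R) * (q%:R * n%:R).
    by rewrite /v /u -pmulrn; field; rewrite !gt_eqF.
  rewrite !(ltr_pM2r qn0) !ltrD2r => /andP[-> h] /=.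
  by apply: lt_le_trans xy.
exists (l1 ++ l2); split.
- rewrite cat_uniq u1 u2 andbT; apply/hasPn => z /h2[_ z0 _].
  by apply/negP => /h1[_ z1 _]; lra.
- move=> z; rewrite mem_cat => /orP[/h1|/h2] [dz _ /in_xy xzy].
    exact: conj dz xzy.
  exact: conj dz xzy.
rewrite size_cat natrD.
have RR : 0 < R%:R :> rat by rewrite ltr0n.
have eb : (3 * N + 2)%:R * E <= 192 * (n%:R / R%:R).
  by rewrite (mulrA 192 n%:R R%:R^-1) (ler_pdivlMr _ _ RR).
have nq0 : 0 <= n%:R / q%:R :> rat by rewrite divr_ge0.
have {}key := ler_wpM2l nq0 key.
have main : kappa * n%:R - kappa * (n%:R / R%:R) <= n%:R / q%:R * (kappa * (q%:R - N%:R^-1)).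
  have -> : n%:R / q%:R * (kappa * (q%:R - N%:R^-1)) =
      kappa * n%:R - kappa * n%:R * (q%:R * N%:R)^-1.
    by field; rewrite !gt_eqF.
  rewrite lerD2l lerN2 (mulrA kappa n%:R R%:R^-1); apply: ler_wpM2l.
    by apply: mulr_ge0; [exact: kappa_ge0|].
  have qN0 : 0 < q%:R * N%:R :> rat by apply: mulr_gt0.
  rewrite (lef_pV2 qN0 RR).
  by rewrite -natrM ler_nat; move: q0 RleN; clear; nia.
have nbig : c <= n%:R.
  by apply: (le_trans R_big); rewrite ler_nat (leq_trans RleN).
have w0 : 0 <= n%:R / R%:R :> rat by rewrite divr_ge0.
have w1 := ler_wpM2l w0 R_big.
rewrite (divfK (lt0r_neq0 RR) n%:R) mulrC in w1.
move: main eb key s1 s2.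
move: (n%:R / R%:R) (n%:R / q%:R) w0 w1 => w a w0 w1 main eb key s1 s2.
rewrite kappaE in main key.
move: (_ * E) (size l1)%:R (size l2)%:R eb s1 s2 => e c1 c2 eb s1 s2.
rewrite ec in w1 nbig; clear -w0 w1 nbig main eb key s1 s2; lra.
Qed.

(** * Pairs of Farey fractions *)

Definition natfrac (a b : nat) : rat := a%:R / b%:R.

Lemma natfrac_num_den (a b : nat) : (0 < b)%N -> coprime a b ->
  numq (natfrac a b) = a /\ denq (natfrac a b) = b.
Proof. exact: fracq_coprime. Qed.

Lemma lt_natfrac (a b c d : nat) : (0 < b)%N -> (0 < d)%N ->
  (natfrac a b < natfrac c d) = (a * d < c * b)%N.
Proof.
move=> b0 d0; rewrite /natfrac ltr_pdivrMr ?ltr0n // mulrAC ltr_pdivlMr ?ltr0n //.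
by rewrite -!natrM ltr_nat.
Qed.

Lemma natfrac_inj (a b c d : nat) : (0 < b)%N -> (0 < d)%N ->
  coprime a b -> coprime c d -> natfrac a b = natfrac c d -> a = c /\ b = d.
Proof.
move=> b0 d0 cab ccd e; have [e1 e2] := natfrac_num_den b0 cab.
have [e3 e4] := natfrac_num_den d0 ccd.
by move: e1 e2; rewrite e e3 e4 => -[->] [->].
Qed.

Lemma natfracP (z : rat) : 0 <= z -> exists a b : nat,
  [/\ (0 < b)%N, coprime a b, z = natfrac a b, numq z = a & denq z = b].
Proof.
move=> z0; have n0 : 0 <= numq z by rewrite numq_ge0.
exists `|numq z|%N, `|denq z|%N; split.
- by rewrite absz_gt0 denq_eq0.
- exact: coprime_num_den.
- rewrite /natfrac -[_%:R]/((`|numq z|%N : int)%:~R) -[X in _ / X]/((`|denq z|%N : int)%:~R).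
  by rewrite !gez0_abs ?denq_ge0 // divq_num_den.
- by rewrite gez0_abs.
- by rewrite gez0_abs ?denq_ge0.
Qed.

Lemma farey_lt (n i j : nat) : (i < size (farey n))%N -> (j < size (farey n))%N ->
  ((farey n)`_i < (farey n)`_j) = (i < j)%N.
Proof.
by move=> hi hj; rewrite (lt_sorted_ltn_nth 0 (farey_sorted n)).
Qed.

Lemma farey_between_ge (n i j : nat) (l : seq rat) :
    (i < j < size (farey n))%N -> uniq l ->
    (forall z, z \in l -> denq z <= n%:Z /\ (farey n)`_i < z < (farey n)`_j) ->
  (size l <= j - i - 1)%N.
Proof.
move=> /andP[ij js] ul hl; have is_ := ltn_trans ij js.
have mem01 k : (k < size (farey n))%N -> 0 <= (farey n)`_k <= 1.
  by move=> /(mem_nth 0); rewrite mem_farey => /andP[].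
have lF z : z \in l -> z \in farey n.
  move=> /hl[dz /andP[iz zj]]; rewrite mem_farey dz andbT.
  have /andP[i0 _] := mem01 i is_; have /andP[_ j1] := mem01 j js.
  by rewrite (le_trans i0 (ltW iz)) (le_trans (ltW zj) j1).
rewrite -(size_map (index^~ (farey n))) -[leqRHS](size_iota i.+1).
apply: uniq_leq_size.
  rewrite map_inj_in_uniq // => z1 z2 /lF z1F /lF z2F e.
  by rewrite -(nth_index 0 z1F) e nth_index.
move=> _ /mapP[z zl ->]; have [_ /andP[iz zj]] := hl z zl.
have zF := lF z zl; have zs : (index z (farey n) < size (farey n))%N by rewrite index_mem.
move: iz zj; rewrite -{1 2}(nth_index 0 zF) !farey_lt // mem_iota => iz zj.
by rewrite iz /=; move: (index _ _) iz zj {zs} => k; clear; lia.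
Qed.

Lemma farey_between_le (n i j : nat) (l : seq rat) :
    (i < j < size (farey n))%N ->
    (forall z, denq z <= n%:Z -> (farey n)`_i < z < (farey n)`_j -> z \in l) ->
  (j - i - 1 <= size l)%N.
Proof.
move=> /andP[ij js] hl; rewrite -[leqLHS](size_iota i.+1).
rewrite -(size_map (nth 0 (farey n))); apply: uniq_leq_size.
  rewrite map_inj_in_uniq ?iota_uniq // => k1 k2; rewrite !mem_iota => h1 h2 e.
  have s1 : (k1 < size (farey n))%N by lia.
  have s2 : (k2 < size (farey n))%N by lia.
  have uF : uniq (farey n) by apply: lt_sorted_uniq; exact: farey_sorted.
  by apply/eqP; rewrite -(nth_uniq 0 s1 s2 uF) e.
move=> _ /mapP[k + ->]; rewrite mem_iota => hk.
have ks : (k < size (farey n))%N by lia.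
have := mem_nth 0 ks; rewrite mem_farey => /andP[_ dk].
apply: hl => //; rewrite !farey_lt //; last by lia.
by apply/andP; split; lia.
Qed.

Lemma farey_gap_le (n a b c d : nat) (l : seq rat) : (4 <= n)%N ->
    (0 < d)%N -> (d < b <= n)%N -> (a < c <= d)%N -> coprime a b -> coprime c d ->
    (forall u v, (0 < u <= n)%N -> coprime v u ->
       (a * u < v * b)%N -> (v * d < c * u)%N -> natfrac v u \in l) ->
  (farey_gap n <= size l)%N.
Proof.
move=> n4 d0 /andP[db bn] /andP[ac cd] cab ccd hl.
have b0 : (0 < b)%N by lia.
have [nx dx] := natfrac_num_den b0 cab; have [ny dy] := natfrac_num_den d0 ccd.
have mem (v u : nat) : (0 < u <= n)%N -> (v <= u)%N -> coprime v u -> natfrac v u \in farey n.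
  move=> /andP[u0 un] vu cvu; rewrite mem_farey; have [_ ->] := natfrac_num_den u0 cvu.
  by rewrite divr_ge0 // ler_pdivrMr ?ltr0n // mul1r ler_nat vu lez_nat.
have xF : natfrac a b \in farey n by apply: mem => //; lia.
have yF : natfrac c d \in farey n by apply: mem => //; lia.
have xy : natfrac a b < natfrac c d by rewrite lt_natfrac //; nia.
have js : (index (natfrac c d) (farey n) < size (farey n))%N by rewrite index_mem.
have is_ : (index (natfrac a b) (farey n) < size (farey n))%N by rewrite index_mem.
have ij : (index (natfrac a b) (farey n) < index (natfrac c d) (farey n))%N.
  by rewrite -(farey_lt is_ js) !nth_index.
have ijs : (index (natfrac a b) (farey n) < index (natfrac c d) (farey n) < size (farey n))%N.
  by rewrite ij.
apply: leq_trans ((farey_gapP n4).2 _ _ ijs _) _.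
  rewrite /opp_ordered /farey_num /farey_den !nth_index // nx ny dx dy.
  by rewrite nmulr_llt0 ?subr_gt0 ?subr_lt0 ltz_nat.
apply: (farey_between_le ijs) => z; rewrite !nth_index // => dz /andP[xz zy].
have z0 : 0 <= z by apply: le_trans (ltW xz); rewrite divr_ge0.
have [v [u [u0 cvu ez _ eu]]] := natfracP z0.
move: xz zy; rewrite ez !lt_natfrac // => h1 h2; apply: hl => //.
by rewrite u0 -lez_nat -eu.
Qed.

Lemma farey_gap_ge (n m : nat) : (4 <= n)%N ->
    (forall a b c d : nat, (0 < d)%N -> (d < b <= n)%N -> (a < c <= d)%N ->
       coprime a b -> coprime c d ->
     exists l : seq rat, [/\ uniq l, (m <= size l)%N &
       forall z, z \in l -> denq z <= n%:Z /\ natfrac a b < z < natfrac c d]) ->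
  (m <= farey_gap n)%N.
Proof.
move=> n4 h; have [[i [j [ijs oij ->]]] _] := farey_gapP n4.
have /andP[ij js] := ijs; have is_ := ltn_trans ij js.
have := mem_nth 0 is_; rewrite mem_farey => /andP[/andP[x0 x1] xn].
have := mem_nth 0 js; rewrite mem_farey => /andP[/andP[y0 y1] yn].
have xy : (farey n)`_i < (farey n)`_j by rewrite farey_lt.
have [a [b [b0 cab ex na db]]] := natfracP x0.
have [c [d [d0 ccd ey nc dd]]] := natfracP y0.
move: oij; rewrite /opp_ordered /farey_num /farey_den na db nc dd.
move: xy xn yn x1 y1; rewrite db dd ex ey lt_natfrac // !lez_nat.
rewrite /natfrac !ler_pdivrMr ?ltr0n // !mul1r !ler_nat => xy bn dn ab cd opp.
(* The other pattern, [c < a] and [b < d], contradicts [a / b < c / d]. *)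
have [ac dltb] : (a < c)%N /\ (d < b)%N.
  have [ac|ca] := ltnP a c.
    by split=> //; move: opp; rewrite pmulr_rlt0 ?subr_gt0 ?ltz_nat // subr_lt0.
  have [bd|db'] := ltnP b d; first by exfalso; move: xy ca bd; clear; nia.
  by move: opp; rewrite ltNge mulr_le0 // subr_le0 lez_nat.
have [l [ul ml hl]] := h a b c d d0 (introT andP (conj dltb bn))
  (introT andP (conj ac cd)) cab ccd.
apply: leq_trans ml _; apply: (farey_between_ge ijs ul) => z /hl.
by rewrite ex ey.
Qed.

(** * Intervals around 1/2 *)

Lemma coprime_2k1 (k : nat) : coprime k k.*2.+1 /\ coprime k.+1 k.*2.+1.
Proof.
split; last by apply/coprimeP => //; exists (2, 1)%N => /=; lia.
by rewrite coprime_sym; apply/coprimeP => //; exists (1, 2)%N => /=; lia.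
Qed.

(** The last two hypotheses say [a / b < kl / (2 kl + 1)] and [(kr + 1) / (2 kr + 1) < c / d]. There
    are [uphalf n] odd denominators up to [n], the [+ 1] counts [1 / 2], and truncated subtraction
    lets a side contribute nothing. *)
Lemma fractions_around_half (n a b c d kl kr : nat) :
    (2 <= n)%N -> (0 < d)%N -> (2 * a < b)%N -> (d < 2 * c)%N ->
    (b < kl.*2.+1 * (b - 2 * a))%N -> (d < kr.*2.+1 * (2 * c - d))%N ->
  exists l : seq rat, [/\ uniq l,
    (uphalf n - kl + (uphalf n - kr) + 1 <= size l)%N &
    forall z, z \in l -> denq z <= n%:Z /\ natfrac a b < z < natfrac c d].
Proof.
move=> n2 d0 ab dc hkl hkr.
have b0 : (0 < b)%N by apply: leq_ltn_trans ab.
have odd_le k : (k < uphalf n)%N -> (k.*2.+1 <= n)%N.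
  by rewrite uphalf_half; have := odd_double_half n; lia.
pose left := [seq natfrac k k.*2.+1 | k <- iota kl (uphalf n - kl)].
pose right := [seq natfrac k.+1 k.*2.+1 | k <- iota kr (uphalf n - kr)].
have leftP z : z \in left -> exists2 k, z = natfrac k k.*2.+1 & (kl <= k < uphalf n)%N.
  by move=> /mapP[k]; rewrite mem_iota => hk ->; exists k => //; move: hk; clear; lia.
have rightP z : z \in right -> exists2 k, z = natfrac k.+1 k.*2.+1 & (kr <= k < uphalf n)%N.
  by move=> /mapP[k]; rewrite mem_iota => hk ->; exists k => //; move: hk; clear; lia.
have left_lt z : z \in left -> z < natfrac 1 2.
  by move=> /leftP[k -> _]; rewrite lt_natfrac //; lia.
have right_gt z : z \in right -> natfrac 1 2 < z.
  by move=> /rightP[k -> _]; rewrite lt_natfrac //; lia.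
exists (left ++ natfrac 1 2 :: right); split.
- rewrite cat_uniq /= !map_inj_in_uniq ?iota_uniq /= ?andbT.
  + apply/andP; split; last first.
      by apply/negP => /right_gt; rewrite ltxx.
    rewrite negb_or; apply/andP; split; first by apply/negP => /left_lt; rewrite ltxx.
    apply/hasPn => z /right_gt h1; apply/negP => /left_lt h2.
    by have := lt_trans h1 h2; rewrite ltxx.
  + move=> k1 k2 _ _ /natfrac_inj[] //.
    * by have [_] := coprime_2k1 k1.
    * by have [_] := coprime_2k1 k2.
    * by case.
  + move=> k1 k2 _ _ /natfrac_inj[] //.
    * by have [] := coprime_2k1 k1.
    * by have [] := coprime_2k1 k2.
- by rewrite size_cat /= !size_map !size_iota; clear; lia.
move=> z; rewrite mem_cat inE => /or3P[zl|/eqP ->|zr].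
- have lt2 := left_lt _ zl; have [k ez /andP[lk ku]] := leftP _ zl.
  have [ck _] := coprime_2k1 k; rewrite ez; rewrite ez in lt2.
  have [_ ->] := natfrac_num_den (ltn0Sn _) ck; split; first by rewrite lez_nat odd_le.
  apply/andP; split; first by rewrite lt_natfrac //; move: lk hkl ab; clear; nia.
  by apply: lt_trans lt2 _; rewrite lt_natfrac // mul1n mulnC.
- have [_ ->] := @natfrac_num_den 1 2 isT isT; split=> //.
  by rewrite !lt_natfrac // !mul1n ![(_ * 2)%N]mulnC ab dc.
have lt2 := right_gt _ zr; have [k ez /andP[lk ku]] := rightP _ zr.
have [_ ck] := coprime_2k1 k; rewrite ez; rewrite ez in lt2.
have [_ ->] := natfrac_num_den (ltn0Sn _) ck; split; first by rewrite lez_nat odd_le.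
apply/andP; split; last by rewrite lt_natfrac //; move: lk hkr dc; clear; nia.
by apply: lt_trans lt2; rewrite lt_natfrac // mul1n mulnC.
Qed.

Lemma leq_U (n : nat) : (U n <= n %/ 4 + 4)%N.
Proof. by rewrite /U; case: (n %% 4)%N => [|[|[|k]]]; lia. Qed.

(** If [b - 2 a] or [2 c - d] is at least 3, that side alone gives about [n / 3] fractions or more.
    Otherwise both are 1 or 2, and [a < c] with [d < b] excludes that both are 1. *)
Lemma many_fractions_around_half (n a b c d : nat) :
    (64 <= n)%N -> (0 < d)%N -> (d < b <= n)%N -> (a < c <= d)%N ->
    coprime a b -> coprime c d -> (2 * a < b)%N -> (d < 2 * c)%N ->
  exists l : seq rat, [/\ uniq l, (U n <= size l)%N &
    forall z, z \in l -> denq z <= n%:Z /\ natfrac a b < z < natfrac c d].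
Proof.
move=> n64 d0 /andP[db bn] /andP[ac cd] cab ccd ab dc.
have n2 : (2 <= n)%N by apply: leq_trans n64.
have Un := leq_U n.
have odd_of (x y : nat) : coprime x y -> odd x || odd y.
  move=> cxy; apply: contraLR isT; rewrite negb_or => /andP[ox oy].
  have : (2 %| gcdn x y)%N by rewrite dvdn_gcd !dvdn2 ox oy.
  by move: cxy; rewrite /coprime => /eqP ->.
have pick (kl kr : nat) : (b < kl.*2.+1 * (b - 2 * a))%N ->
    (d < kr.*2.+1 * (2 * c - d))%N ->
    (U n <= uphalf n - kl + (uphalf n - kr) + 1)%N ->
  exists l : seq rat, [/\ uniq l, (U n <= size l)%N &
    forall z, z \in l -> denq z <= n%:Z /\ natfrac a b < z < natfrac c d].
  move=> h1 h2 h3; have [l [ul sl hl]] := fractions_around_half n2 d0 ab dc h1 h2.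
  by exists l; split=> //; apply: leq_trans sl.
have oab := odd_of _ _ cab; have ocd := odd_of _ _ ccd.
have eU : uphalf n = ((n + 1) %/ 2)%N by rewrite uphalf_half; have := odd_double_half n; lia.
(* Taking [kl = n] discards the left side; [64 <= n] makes the right side exceed [n / 4 + 4]. *)
have [t2|t2] := leqP 3 (2 * c - d).
  apply: (pick n (d %/ 6 + 1)%N); rewrite ?eU; clear pick odd_of; first by nia.
    by have := divn_eq d 6; have := ltn_pmod d (isT : 0 < 6)%N; nia.
  by lia.
have [t1|t1] := leqP 3 (b - 2 * a).
  apply: (pick (b %/ 6 + 1)%N n); rewrite ?eU; clear pick odd_of; last by lia.
    by have := divn_eq b 6; have := ltn_pmod b (isT : 0 < 6)%N; nia.
  by nia.
have [[e1 e2]|[[e1 e2]|[e1 e2]]] : 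
    (b = 2 * a + 2 /\ 2 * c = d + 2 \/ b = 2 * a + 1 /\ 2 * c = d + 2 \/
     b = 2 * a + 2 /\ 2 * c = d + 1)%N.
  by move: ab dc t1 t2 ac db; clear; lia.
- apply: (pick (b %/ 4 + 1)%N (d %/ 4 + 1)%N); rewrite ?eU; clear pick odd_of.
  + have -> : (b - 2 * a = 2)%N by lia.
    by lia.
  + have -> : (2 * c - d = 2)%N by lia.
    by lia.
  + by lia.
(* First extremal family: parity makes the pair [2 e / (4 e + 1)], [(2 e + 1) / (4 e)], and the
   count is exactly [U n] when [e = n %/ 4]. *)
- have e3 : d = (2 * a)%N by move: db ac e1 e2; clear; lia.
  have oc : odd c by move: ocd; rewrite e3 mul2n odd_double orbF.
  pose e := (a %/ 2)%N; have ea : a = (2 * e)%N by move: oc e2 e3; rewrite /e; clear; lia.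
  apply: (pick a.+1 e).
  + have -> : (b - 2 * a = 1)%N by lia.
    by lia.
  + have -> : (2 * c - d = 2)%N by lia.
    by lia.
  by rewrite eU /U; move: (n %% 4)%N (divn_eq n 4) (ltn_pmod n (isT : 0 < 4)%N)
    => [|[|[|[|r]]]]; move: ea e1 bn; clear; lia.
(* Second extremal family: the pair is [(2 e - 1) / (4 e)], [2 e / (4 e - 1)], with count exactly
   [U n] when [n = 4 e]. *)
have oa : odd a by move: oab; rewrite e1 addn2 /= mul2n odd_double orbF.
pose e := (a.+1 %/ 2)%N; have ea : a.+1 = (2 * e)%N by move: oa; rewrite /e; clear; lia.
have e3 : d = (2 * a + 1)%N by move: db ac e1 e2; clear; lia.
apply: (pick e a.+1).
+ have -> : (b - 2 * a = 2)%N by lia.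
  by lia.
+ have -> : (2 * c - d = 1)%N by lia.
  by lia.
by rewrite eU /U; move: (n %% 4)%N (divn_eq n 4) (ltn_pmod n (isT : 0 < 4)%N)
  => [|[|[|[|r]]]]; move: ea e1 bn; clear; lia.
Qed.

(** * The optimal pairs *)

(** Between [1 / 2] and the right end all denominators exceed [4 m]; on the left a fraction [v / u]
    satisfies [u > 2 m (u - 2 v)], which forces [u = 2 v + 1]. *)
Lemma farey_gap_le_mod0 (m : nat) : (2 <= m)%N ->
  (farey_gap (4 * m) <= m + 1)%N.
Proof.
move=> m2.
pose l := natfrac 1 2 :: [seq natfrac v v.*2.+1 | v <- iota m m].
have -> : (m + 1)%N = size l by rewrite /= size_map size_iota addn1.
have cab : coprime (2 * m - 1) (4 * m).
  rewrite coprime_sym; apply/coprimeP; first by lia.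
  by exists (m, 2 * m + 1)%N => /=; nia.
have ccd : coprime (2 * m) (4 * m - 1).
  by apply/coprimeP; [lia|exists (2, 1)%N => /=; lia].
apply: (@farey_gap_le _ _ _ _ _ l _ _ _ _ cab ccd); try by clear -m2; lia.
move=> u v un cvu h1 h2; rewrite inE.
have [e|uv] := eqVneq u (2 * v)%N.
  have v1 : v = 1%N.
    by move: cvu; rewrite e /coprime gcdnMl => /eqP.
  by rewrite e v1 eqxx.
apply/orP; right; apply/mapP; exists v; last by congr natfrac; nia.
by rewrite mem_iota; nia.
Qed.

(** One pair serves all three remainders; for [r = 3] the denominator [4 m + 3] adds one fraction on
    each side of [1 / 2]. *)
Lemma farey_gap_le_mod123 (m r : nat) : (2 <= m)%N -> (0 < r < 4)%N ->
  (farey_gap (4 * m + r) <= if r == 3 then m + 4 else m + 2)%N.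
Proof.
move=> m2 r4.
pose k := if r == 3%N then m.+2 else m.+1.
pose l := natfrac 1 2 :: (if r == 3%N then [:: natfrac (2 * m + 1) (4 * m + 3)] else [::])
   ++ [seq natfrac v (2 * v - 1) | v <- iota m.+1 k].
have -> : (if r == 3 then m + 4 else m + 2)%N = size l.
  by rewrite /= size_cat size_map size_iota /k; case: eqP => _ /=; clear; lia.
have cab : coprime (2 * m) (4 * m + 1).
  by rewrite coprime_sym; apply/coprimeP; [lia|exists (1, 2)%N => /=; lia].
have ccd : coprime (2 * m + 1) (4 * m).
  apply/coprimeP; [lia|exists (2 * m + 1, m + 1)%N => /=; nia].
apply: (@farey_gap_le _ _ _ _ _ l _ _ _ _ cab ccd); try by clear -m2 r4; lia.
move=> u v un cvu h1 h2; rewrite inE.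
have [e|uv] := eqVneq u (2 * v)%N.
  have v1 : v = 1%N.
    by move: cvu; rewrite e /coprime gcdnMl => /eqP.
  by rewrite e v1 eqxx.
apply/orP; right; rewrite mem_cat.
(* On the left of [1 / 2], [u - 2 v >= 1] forces [v > 2 m], hence [u >= 4 m + 3]. *)
have [vu|uv2] := ltnP (2 * v) u.
  have [r3 [e1 e2]] : r = 3%N /\ v = (2 * m + 1)%N /\ u = (4 * m + 3)%N by nia.
  by rewrite r3 /= e1 e2 mem_head.
have nev : ~~ ((2 %| v)%N && (2 %| u)%N).
  by apply/negP => h; move: (dvdn_gcd 2 v u); rewrite h; move/eqP: cvu => ->.
have [s es] : exists s, (u + s = 2 * v)%N by exists (2 * v - u)%N; rewrite subnKC.
have s0 : (0 < s)%N by move: es uv; clear; lia.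
have su : (2 * m * s < u)%N by move: h2 es; clear; nia.
have s3 : (s < 3)%N by move: su un r4 m2; clear; nia.
have s1 : s = 1%N.
  (* If [s = 2], then [u = 4 m + 2] and [v = 2 m + 2] are both even. *)
  have [//|s2] : s = 1%N \/ s = 2%N by move: s0 s3; clear; lia.
  by move: nev; rewrite !dvdn2; move: es su un r4; rewrite s2; clear; lia.
apply/orP; right; apply/mapP; exists v; last first.
  by congr natfrac; move: es; rewrite s1; clear; lia.
by rewrite mem_iota /k; move: es su un r4; rewrite s1; clear; case: eqP; lia.
Qed.

Lemma farey_gap_le_U (n : nat) : (8 <= n)%N -> (farey_gap n <= U n)%N.
Proof.
move=> n8; have r4 := ltn_pmod n (isT : 0 < 4)%N.
have en : (4 * (n %/ 4) + n %% 4 = n)%N by rewrite mulnC -divn_eq.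
have m2 : (2 <= n %/ 4)%N by rewrite leq_divRL.
have [r0|r0] := posnP (n %% 4).
  have := farey_gap_le_mod0 m2; rewrite /U r0.
  by rewrite r0 addn0 in en; rewrite en.
have := @farey_gap_le_mod123 _ (n %% 4) m2 (introT andP (conj r0 r4)).
by rewrite en /U; move: r0 r4; move: (n %% 4)%N => [|[|[|[|r]]]].
Qed.

Local Close Scope ring_scope.

(** * Equality of the two bounds for all large orders *)

Theorem theorem1p2 :
  exists N0 : nat, 4 <= N0 /\ forall n : nat, N0 <= n -> farey_gap n = U n.
Proof.
have [N1 many] := many_fractions.
exists (maxn N1 64); split; first by rewrite leq_max orbT.
move=> n; rewrite geq_max => /andP[nN1 n64]; apply/eqP; rewrite eqn_leq.
rewrite farey_gap_le_U /=; last by apply: leq_trans n64.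
have n4 : 4 <= n by apply: leq_trans n64.
apply: farey_gap_ge => // a b c d d0 dbn acd cab ccd.
have [/andP[ab dc]|nhalf] := boolP ((2 * a < b) && (d < 2 * c)).
  exact: many_fractions_around_half.
have /andP[db bn] := dbn; have /andP[ac cd] := acd.
have b0 : 0 < b by apply: leq_ltn_trans db.
have a0 : 0 < a.
  rewrite lt0n; apply/eqP => a0; move: cab; rewrite a0 /coprime gcd0n => /eqP b1.
  by move: db; rewrite b1 ltnS leqNgt d0.
have [_ db_] := natfrac_num_den b0 cab.
have [l [ul hl sl]] : exists l : seq rat, [/\ uniq l,
    forall z, z \in l -> (denq z <= n%:Z /\ natfrac a b < z < natfrac c d)%R &
    (n%:R / 4 + 4 <= (size l)%:R :> rat)%R].
  apply: many => //.
  - by rewrite divr_gt0 // ltr0n.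
  - by rewrite db_ lez_nat.
  - by rewrite /natfrac ler_pdivrMr ?ltr0n // mul1r ler_nat.
  (* The intermediate fraction is [a / b + (1 + a / b) / b]; it is at most [(a + 1) / (b - 1)], and
     [b <= n]. *)
  - apply: (@le_trans _ _ (natfrac (a * b + a + b) (b * b))).
      have -> : (natfrac (a * b + a + b) (b * b) =
          natfrac a b + (1 + natfrac a b) / b%:R)%R.
        rewrite /natfrac !natrD !natrM; field.
        by rewrite pnatr_eq0 -lt0n.
      rewrite lerD2l ler_wpM2l //; first by rewrite addr_ge0 ?ler01 ?divr_ge0.
      by rewrite lef_pV2 ?posrE ?ltr0n ?ler_nat // (leq_trans b0).
    rewrite leNgt lt_natfrac ?muln_gt0 ?b0 // -leqNgt.
    apply: (@leq_trans (a.+1 * (b * b))); last by rewrite leq_mul2r ac orbT.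
    apply: (@leq_trans ((a * b + a + b) * b.-1)).
      by rewrite leq_mul2l -ltnS prednK // db orbT.
    by case: (b) b0 => // e _; clear; nia.
  apply: contra nhalf.
  by rewrite -[(1 / 2)%R]/(natfrac 1 2) !lt_natfrac // mulnC !mul1n [(c * 2)%N]mulnC.
exists l; split=> //; rewrite -(ler_nat rat); apply: le_trans sl.
have := leq_U n; rewrite -(ler_nat rat) => h; apply: le_trans h _.
rewrite natrD lerD2r ler_pdivlMr // -natrM ler_nat.
exact: leq_trunc_div.
Qed.
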